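(* Suppose the $\varepsilon$-decomposition assumption holds with $\mu=\mu_Q+\mu_R=0$ and the stochastic oracle assumption holds with $\rho=0$. Let $\varepsilon=L_R/L$ and $\|r_0\|=\|x_0-x_*\|$. Run Local SGD on $M$ devices for $T=KH$ iterations from $x_0$ with constant stepsize $$\gamma_t=\gamma=\begin{cases}\min\left\{\frac{1}{6L},\frac{\|r_0\|\sqrt M}{\sigma\sqrt T}\right\}, & \text{if } H=1\text{ or }M=1,\\[4pt] \min\left\{\frac{1}{6L},\frac{\|r_0\|\sqrt M}{\sigma\sqrt T},\left(\frac{\|r_0\|^2}{L_R\sigma^2TH}\right)^{1/3}\right\}, & \text{otherwise.}\end{cases}$$ Then there is an absolute constant $A>0$ such that, with $\tilde x_T=\frac1T\sum_{t=0}^{T-1}\bar x_t$, $$\mathbb{E}[F(\tilde x_T)]-F(x_* )\le A\left(\frac{L\|r_0\|^2}{T}+\frac{\sigma\|r_0\|}{\sqrt{MT}}+\left(\frac{\varepsilon L\sigma^2\|r_0\|^4}{TK}\right)^{1/3}\right).$$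
   Context: Problem: minimize $F(x)=\mathbb{E}_{z\sim\mathcal D}[F(x,z)]$ over $x\in\mathbb{R}^d$ (the same $F$ and $\mathcal D$ on all $M$ devices); $x_*$ denotes a minimizer of $F$, assumed to exist. Norms are Euclidean. Fractions with zero denominator in a minimum are read as $+\infty$. A differentiable $f$ is $\mu$-strongly convex ($\mu\ge0$) and $L$-smooth if $\frac{\mu}{2}\|x-y\|^2\le f(y)-f(x)-\langle\nabla f(x),y-x\rangle\le\frac{L}{2}\|x-y\|^2$ for all $x,y\in\mathbb{R}^d$. $\varepsilon$-decomposition assumption: $F=Q+R$, where $Q$ is a quadratic function that is $\mu_Q$-strongly convex and $L_Q$-smooth, $R$ is $\mu_R$-strongly convex and $L_R$-smooth ($\mu_Q,\mu_R\ge0$), and $F$ is $L$-smooth. Stochastic oracle assumption: there are constants $\sigma,\rho\ge0$ such that for all $x$, $\mathbb{E}_{z\sim\mathcal D}[\nabla F(x,z)]=\nabla F(x)$ and $\mathbb{E}_{z\sim\mathcal D}\|\nabla F(x,z)-\nabla F(x)\|^2\le\sigma^2+\rho\|\nabla F(x)\|^2$. Local SGD: $x_0^m=x_0$ for $m=1,\dots,M$; $H$ is the number of local steps, $K$ the number of communication rounds, $T=KH$, $\gamma_t$ the stepsizes. For $t=0,\dots,T-1$, each device $m$ draws $z_t^m\sim\mathcal D$ (all draws independent over $m$ and $t$) and sets $\mathbf g_t^m=\nabla F(x_t^m,z_t^m)$. If $H$ divides $t+1$, then $x_{t+1}^m=\frac1M\sum_{j=1}^M(x_t^j-\gamma_t\mathbf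 g_t^j)$ for all $m$; otherwise $x_{t+1}^m=x_t^m-\gamma_t\mathbf g_t^m$. Let $\bar x_t=\frac1M\sum_{m=1}^M x_t^m$. An absolute constant does not depend on any problem or algorithm parameter. *)

(* Defs.v *)
From HB Require Import structures.
From mathcomp Require Import all_boot all_order all_algebra.
From mathcomp Require Import all_classical all_reals all_analysis.

Set Implicit Arguments.
Unset Strict Implicit.
Unset Printing Implicit Defensive.

Import Order.TTheory GRing.Theory Num.Theory.
Import numFieldNormedType.Exports.

Local Open Scope classical_set_scope.
Local Open Scope ring_scope.

(* The library norm on 'rV[R]_d is the sup norm, hence the Euclidean one here;
   both induce the same topology and the same notion of differentiability. *)
Definition dotv (R : realType) (d : nat) (u v : 'rV[R]_d) : R :=
  \sum_(i < d) u 0 i * v 0 i.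

Definition enorm (R : realType) (d : nat) (u : 'rV[R]_d) : R :=
  Num.sqrt (dotv u u).

Definition grad (R : realType) (d : nat) (f : 'rV[R]_d -> R) (x : 'rV[R]_d) :
    'rV[R]_d :=
  \row_(i < d) 'D_(delta_mx 0 i) f x.

Definition strongly_convex (R : realType) (d : nat) (mu : R)
    (f : 'rV[R]_d -> R) : Prop :=
  (forall x, differentiable f x) /\
  forall x y,
    mu / 2 * enorm (x - y) ^+ 2 <= f y - f x - dotv (grad f x) (y - x).

(* Upper half of the two-sided inequality; it is the usual notion of
   smoothness for convex functions. *)
Definition smooth (R : realType) (d : nat) (L : R)
    (f : 'rV[R]_d -> R) : Prop :=
  (forall x, differentiable f x) /\
  forall x y,
    f y - f x - dotv (grad f x) (y - x) <= L / 2 * enorm (x - y) ^+ 2.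

Definition quadratic (R : realType) (d : nat) (f : 'rV[R]_d -> R) : Prop :=
  exists (A : 'M[R]_d) (b : 'rV[R]_d) (c : R),
    forall x, f x = dotv (x *m A) x + dotv b x + c.

Definition eps_decomposition (R : realType) (d : nat)
    (f Q r : 'rV[R]_d -> R) (muQ LQ muR LR L : R) : Prop :=
  [/\ forall x, f x = Q x + r x,
      [/\ quadratic Q, 0 <= muQ, strongly_convex muQ Q & smooth LQ Q],
      [/\ 0 <= muR, strongly_convex muR r & smooth LR r] &
      smooth L f].

(* Measurability in z of F(x, z) and differentiability in x of F(x, z); these
   entail that (x, z) |-> F(x, z) and its x-gradient are jointly measurable. *)
Definition stochastic_function (R : realType) (d : nat)
    (dZ : measure_display) (Z : measurableType dZ) (D : probability Z R)
    (F : 'rV[R]_d -> Z -> R) : Prop :=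
  (forall x, D.-integrable [set: Z] (EFin \o F x)) /\
  (forall z x, differentiable (fun y => F y z) x).

Definition objective (R : realType) (d : nat)
    (dZ : measure_display) (Z : measurableType dZ) (D : probability Z R)
    (F : 'rV[R]_d -> Z -> R) (x : 'rV[R]_d) : R :=
  fine ('E_D[F x])%E.

Definition sgrad (R : realType) (d : nat) (Z : Type)
    (F : 'rV[R]_d -> Z -> R) (x : 'rV[R]_d) (z : Z) : 'rV[R]_d :=
  grad (fun y => F y z) x.

Definition stochastic_oracle (R : realType) (d : nat)
    (dZ : measure_display) (Z : measurableType dZ) (D : probability Z R)
    (F : 'rV[R]_d -> Z -> R) (sigma rho : R) : Prop :=
  [/\ 0 <= sigma, 0 <= rho,
      forall x (i : 'I_d),
        ('E_D[fun z => (sgrad F x z 0 i)%R] = (grad (objective D F) x 0 i)%:E)%E &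
      forall x,
        ('E_D[fun z => (enorm (sgrad F x z - grad (objective D F) x) ^+ 2)%R] <=
         (sigma ^+ 2 + rho * enorm (grad (objective D F) x) ^+ 2)%:E)%E].

Definition mutually_independent (R : realType)
    (dO dZ : measure_display) (Omega : measurableType dO)
    (Z : measurableType dZ) (P : probability Omega R)
    (I : finType) (X : I -> {RV P >-> Z}) : Prop :=
  forall (J : {set I}) (B : I -> set Z),
    (forall i, i \in J -> measurable (B i)) ->
    P (\bigcap_(i in [set` J]) (X i @^-1` B i)) =
    (\prod_(i in J) P (X i @^-1` B i))%E.

(* Only the draws z t m with t < T are constrained. *)
Definition iid_draws (R : realType)
    (dO dZ : measure_display) (Omega : measurableType dO)
    (Z : measurableType dZ) (P : probability Omega R) (D : probability Z R)
    (T M : nat) (z : nat -> 'I_M -> {RV P >-> Z}) : Prop :=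
  (forall t m, (t < T)%N ->
     forall B, measurable B -> distribution P (z t m) B = D B) /\
  mutually_independent (fun k : 'I_T * 'I_M => z k.1 k.2).

Definition device_mean (R : realType) (d M : nat) (y : 'I_M -> 'rV[R]_d) :
    'rV[R]_d :=
  M%:R^-1 *: \sum_(j < M) y j.

(* Iterates along one realization zs of the draws. *)
Fixpoint local_sgd (R : realType) (d M : nat) (Z : Type)
    (F : 'rV[R]_d -> Z -> R) (H : nat) (gamma : nat -> R) (x0 : 'rV[R]_d)
    (zs : nat -> 'I_M -> Z) (t : nat) {struct t} : 'I_M -> 'rV[R]_d :=
  match t with
  | 0%N => fun=> x0
  | s.+1 =>
      let x := local_sgd F H gamma x0 zs s in
      let y := fun m => x m - gamma s *: sgrad F (x m) (zs s m) in
      if (H %| s.+1)%N then fun=> device_mean y else y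
  end.

Definition local_sgd_avg (R : realType) (d M : nat) (Z : Type)
    (F : 'rV[R]_d -> Z -> R) (H : nat) (gamma : nat -> R) (x0 : 'rV[R]_d)
    (zs : nat -> 'I_M -> Z) (T : nat) : 'rV[R]_d :=
  T%:R^-1 *: \sum_(t < T) device_mean (local_sgd F H gamma x0 zs t).

Definition divy (R : realType) (a b : R) : \bar R :=
  if b == 0 then +oo%E else (a / b)%:E.

Definition stepsize (R : realType) (L LR sigma r0 : R) (M H T : nat) : \bar R :=
  let a := divy 1 (6 * L) in
  let b := divy (r0 * Num.sqrt M%:R) (sigma * Num.sqrt T%:R) in
  let c := poweR (divy (r0 ^+ 2) (LR * sigma ^+ 2 * T%:R * H%:R)) 3^-1 in
  if (H == 1)%N || (M == 1)%N then Order.min a b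
  else Order.min a (Order.min b c).

(* Main.v *)
Require Import Defs.
From HB Require Import structures.
From mathcomp Require Import all_boot all_order all_algebra.
From mathcomp Require Import all_classical all_reals all_analysis.
From mathcomp Require Import measurable_realfun ring lra.

Set Implicit Arguments.
Unset Strict Implicit.
Unset Printing Implicit Defensive.

Import Order.TTheory GRing.Theory Num.Theory.
Import numFieldNormedType.Exports.
Local Open Scope classical_set_scope.
Local Open Scope ring_scope.

(** Write [xb] for the mean of the devices, [f = Q + r] for the decomposition
    and [xs] for the minimizer.

    One-step inequality ([mean_descent]). The gradient of the quadratic part is
    affine, so it commutes with averaging over devices; the average [G] of the
    gradients differs from the gradient at [xb] only through [r]. Convexity of
    [Q] at [xb], and convexity and LR-smoothness of [r] at each device, give
    [<G, xb - xs> >= f xb - f xs - (LR / 2) * S], where [S] is the mean squared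
    distance of the devices to [xb]. Moreover [|G|^2] is at most
    [4 L (f xb - f xs) + 2 L LR S], by cocoercivity of the gradients; this uses
    that [r] is also L-smooth, because [Q] is convex. For [gamma <= 1 / (6 L)]
    the second-order terms are absorbed.

    Consensus ([pairwise_consensus]). All devices minimize the same function,
    and a gradient step on a smooth convex function is nonexpansive. Between two
    communications the expected squared distance of two devices therefore grows
    only by the variance of the two noises, and [E S] is of order
    [gamma^2 sigma^2 H].

    Noise ([noise_sum]). A draw is independent of all the others, so these can
    be frozen while it is integrated out ([freezing]): the joint law is a
    product measure by a pi-lambda argument, and the Tonelli theorem applies.
    Removing the draws of one time step one by one shows that the centred noises
    add up in mean square. Only nonnegative integrands occur, so no
    integrability of the iterates has to be established beforehand. Joint
    measurability in the iterate and the draw is that of Caratheodory functions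
    ([measurable_caratheodory]), gradients being limits of difference quotients.

    Summing over time and using convexity, the expected gap at the averaged
    iterate is at most [r0^2 / (gamma T) + LR * consensus + gamma sigma^2 / M]
    ([expected_gap_average]); the stepsize balances the three terms
    ([stepsize_balance]). *)

(** * Euclidean inner product *)

Section EuclideanSpace.
Context {R : realType} {d : nat}.
Implicit Types u v w : 'rV[R]_d.

Lemma dotvC u v : dotv u v = dotv v u.
Proof. by apply: eq_bigr => i _; rewrite mulrC. Qed.

Lemma dotvDl u v w : dotv (u + v) w = dotv u w + dotv v w.
Proof.
by rewrite /dotv -big_split; apply: eq_bigr => i _; rewrite !mxE mulrDl.
Qed.

Lemma dotvZl a u w : dotv (a *: u) w = a * dotv u w.
Proof.
by rewrite /dotv mulr_sumr; apply: eq_bigr => i _; rewrite !mxE mulrA.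
Qed.

Lemma dotvNl u w : dotv (- u) w = - dotv u w.
Proof. by rewrite -scaleN1r dotvZl mulN1r. Qed.

Lemma dotv0l w : dotv 0 w = 0.
Proof. by rewrite -(scale0r (0 : 'rV[R]_d)) dotvZl mul0r. Qed.

Lemma dotvDr u v w : dotv w (u + v) = dotv w u + dotv w v.
Proof. by rewrite dotvC dotvDl !(dotvC w). Qed.

Lemma dotvZr a u w : dotv w (a *: u) = a * dotv w u.
Proof. by rewrite dotvC dotvZl (dotvC w). Qed.

Lemma dotvNr u w : dotv w (- u) = - dotv w u.
Proof. by rewrite dotvC dotvNl (dotvC w). Qed.

Definition dotvE := (dotvDl, dotvDr, dotvNl, dotvNr, dotvZl, dotvZr).

Lemma dotv_suml (I : Type) (s : seq I) (P : pred I) (F : I -> 'rV[R]_d) w :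
  dotv (\sum_(i <- s | P i) F i) w = \sum_(i <- s | P i) dotv (F i) w.
Proof.
by elim/big_rec2: _ => [|i a u _ <-]; rewrite ?dotv0l ?dotvDl.
Qed.

Lemma dotv_sumr (I : Type) (s : seq I) (P : pred I) (F : I -> 'rV[R]_d) w :
  dotv w (\sum_(i <- s | P i) F i) = \sum_(i <- s | P i) dotv w (F i).
Proof. by rewrite dotvC dotv_suml; apply: eq_bigr => i _; rewrite dotvC. Qed.

Lemma dotvv_ge0 u : 0 <= dotv u u.
Proof. by apply: sumr_ge0 => i _; rewrite -expr2 sqr_ge0. Qed.

Lemma sqr_enorm u : enorm u ^+ 2 = dotv u u.
Proof. by rewrite /enorm sqr_sqrtr // dotvv_ge0. Qed.

Lemma enorm_ge0 u : 0 <= enorm u.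
Proof. exact: sqrtr_ge0. Qed.

Lemma dotvv_eq0 u : dotv u u = 0 -> u = 0.
Proof.
move=> /eqP; rewrite psumr_eq0 => [/allP u0|i _]; last first.
  by rewrite -expr2 sqr_ge0.
apply/rowP => i; rewrite mxE.
by have := u0 i (mem_index_enum _); rewrite /= -expr2 sqrf_eq0 => /eqP.
Qed.

Lemma dotv_le u v : 2 * dotv u v <= dotv u u + dotv v v.
Proof. by have := dotvv_ge0 (u - v); rewrite !dotvE (dotvC v u); lra. Qed.

Lemma dotv_sum_le n (F : 'I_n -> 'rV[R]_d) :
  dotv (\sum_i F i) (\sum_i F i) <= n%:R * \sum_i dotv (F i) (F i).
Proof.
have -> : n%:R * \sum_i dotv (F i) (F i) =
    \sum_i \sum_j (dotv (F i) (F i) + dotv (F j) (F j)) / 2.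
  pose S := \sum_i dotv (F i) (F i); rewrite -/S.
  have rowE i : \sum_j (dotv (F i) (F i) + dotv (F j) (F j)) / 2 =
      (n%:R * dotv (F i) (F i) + S) / 2.
    by rewrite -mulr_suml big_split /= sumr_const card_ord mulr_natl.
  rewrite (eq_bigr _ (fun i _ => rowE i)) -mulr_suml big_split /= -mulr_sumr.
  by rewrite sumr_const card_ord -/S -(mulr_natl S); field.
rewrite dotv_suml; apply: ler_sum => i _; rewrite dotv_sumr.
apply: ler_sum => j _.
by rewrite ler_pdivlMr // mulrC dotv_le.
Qed.

End EuclideanSpace.

(** * Smooth convex functions *)

Section SmoothConvex.
Context {R : realType} {d : nat}.
Implicit Types (x y : 'rV[R]_d) (f : 'rV[R]_d -> R).

(** Bregman divergence: the error at [y] of the first-order expansion of [f]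
    at [x]. *)
Definition bregman f y x := f y - f x - dotv (grad f x) (y - x).

Lemma bregman_ge0 f y x : strongly_convex 0 f -> 0 <= bregman f y x.
Proof. by move=> [_ /(_ x y)]; rewrite !mul0r. Qed.

Lemma bregman_le L f y x :
  smooth L f -> bregman f y x <= L / 2 * dotv (x - y) (x - y).
Proof. by move=> [_ /(_ x y)]; rewrite sqr_enorm. Qed.

(** The affine lower bound of [f] at [y] is below its quadratic upper bound at
    [x]; the inequality is this comparison at the point that minimizes the
    difference of the two bounds. *)
Lemma cocoercive L f x y : 0 < L -> strongly_convex 0 f -> smooth L f ->
  dotv (grad f x - grad f y) (grad f x - grad f y) <= 2 * L * bregman f x y.
Proof.
move=> L0 cf sf; set g : 'rV[R]_d := grad f x - grad f y.
pose w : 'rV[R]_d := x - L^-1 *: g.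
have cw := bregman_ge0 w y cf.
have := bregman_le w x sf.
move: cw; rewrite /bregman.
have -> : w - y = (x - y) - L^-1 *: g by rewrite /w addrAC.
have -> : w - x = - (L^-1 *: g) by rewrite /w addrAC subrr add0r.
have -> : x - w = L^-1 *: g by rewrite /w opprB addrCA subrr addr0.
rewrite dotvDr !dotvNr !dotvZr dotvZl => cw sw.
have E : dotv g g = dotv (grad f x) g - dotv (grad f y) g.
  by rewrite {1}/g dotvDl dotvNl.
have : L^-1 * dotv g g / 2 <= f x - f y - dotv (grad f y) (x - y).
  move: sw.
  rewrite (_ : L / 2 * (L^-1 * (L^-1 * dotv g g)) = L^-1 * dotv g g / 2);
    last by field; rewrite gt_eqF.
  move: cw; rewrite E !mulrBr; lra.
rewrite (_ : L^-1 * dotv g g / 2 = dotv g g / (2 * L));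
  last by field; rewrite gt_eqF.
by rewrite ler_pdivrMr ?mulr_gt0 // mulrC.
Qed.

(** The gradient step of length [L^-1] decreases [f] by at least half of
    [L^-1] times the squared norm of the gradient. *)
Lemma sqr_grad_le L f x xs : 0 < L -> smooth L f -> (forall y, f xs <= f y) ->
  dotv (grad f x) (grad f x) <= 2 * L * (f x - f xs).
Proof.
move=> L0 sf fmin; set g : 'rV[R]_d := grad f x.
have := bregman_le (x - L^-1 *: g) x sf; have := fmin (x - L^-1 *: g).
rewrite /bregman -/g.
rewrite [x - _ - x]addrAC subrr add0r [- (x - _)]opprB [x + (_ - x)]addrCA.
rewrite subrr addr0 dotvNr !dotvZr dotvZl.
rewrite (_ : L / 2 * (L^-1 * (L^-1 * dotv g g)) = L^-1 * dotv g g / 2);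
  last by field; rewrite gt_eqF.
move=> h1 h2.
have : L^-1 * dotv g g / 2 <= f x - f xs by lra.
rewrite (_ : L^-1 * dotv g g / 2 = dotv g g / (2 * L));
  last by field; rewrite gt_eqF.
by rewrite ler_pdivrMr ?mulr_gt0 // mulrC.
Qed.

(** A gradient step of length at most [2 / L] is nonexpansive. *)
Lemma gradient_step_nonexpansive L gamma f x y :
  0 < L -> 0 <= gamma -> gamma * L <= 2 -> strongly_convex 0 f -> smooth L f ->
  dotv ((x - gamma *: grad f x) - (y - gamma *: grad f y))
       ((x - gamma *: grad f x) - (y - gamma *: grad f y)) <=
  dotv (x - y) (x - y).
Proof.
move=> L0 g0 gL cf sf; set w : 'rV[R]_d := (_ - _ - _).
have := cocoercive x y L0 cf sf; have := cocoercive y x L0 cf sf.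
rewrite /=.
set g : 'rV[R]_d := grad f x - grad f y.
have -> : grad f y - grad f x = - g by rewrite /g opprB.
have -> : w = (x - y) - gamma *: g.
  by apply/rowP => i; rewrite !mxE; ring.
rewrite dotvNl dotvNr opprK => h1 h2.
have B : bregman f x y + bregman f y x = dotv g (x - y).
  by rewrite /bregman /g !dotvE; ring.
have K : dotv g g <= L * dotv g (x - y).
  by rewrite -B mulrDr; lra.
have gg := dotvv_ge0 g.
have K2 : gamma * dotv g g <= 2 * dotv g (x - y).
  have gpos : 0 <= dotv g (x - y).
    by rewrite -(pmulr_rge0 _ L0); exact: le_trans K.
  apply: (le_trans (ler_wpM2l g0 K)); rewrite mulrA.
  exact: ler_wpM2r.
have := ler_wpM2l g0 K2.
by clearbody g; move: (x - y) => u; rewrite !dotvE (dotvC u g) => K3; lra.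
Qed.

End SmoothConvex.

(** * Quadratic part and averages over devices *)

Section Decomposition.
Context {R : realType} {d : nat}.
Implicit Types (u v w x y : 'rV[R]_d) (f Q r : 'rV[R]_d -> R).

Lemma dotv_delta i u : dotv (delta_mx 0 i) u = u 0 i.
Proof.
rewrite /dotv (bigD1 i) //= !mxE !eqxx mul1r big1 ?addr0 // => j ji.
by rewrite !mxE (negbTE ji) mul0r.
Qed.

Lemma dotv_mulmx (A : 'M[R]_d) u v : dotv (u *m A) v = dotv u (v *m A^T).
Proof.
have dotv_mx (a b : 'rV[R]_d) : dotv a b = (a *m b^T) 0 0.
  by rewrite /dotv mxE; apply: eq_bigr => i _; rewrite !mxE.
by rewrite !dotv_mx trmx_mul trmxK mulmxA.
Qed.

Lemma quadratic_grad Q :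
  quadratic Q -> exists (B : 'M[R]_d) b, forall x, grad Q x = x *m B + b.
Proof.
move=> [A [b [c QE]]]; exists (A^T + A), b => x.
apply/rowP => i; rewrite mxE.
set e := delta_mx 0 i.
have -> : (x *m (A^T + A) + b) 0 i =
    dotv (e *m A) x + dotv (x *m A) e + dotv b e.
  rewrite (dotv_mulmx A e) (dotvC (x *m A)) (dotvC b) -!dotvDr.
  by rewrite dotv_delta mulmxDr.
apply: cvg_lim => //.
set l := (X in _ --> X).
pose k := dotv (e *m A) e.
suff : (h * k + l) @[h --> (0 : R)^'] --> l.
  apply: cvg_trans; apply: near_eq_cvg; near=> h.
  have h0 : h != 0 by near: h; exact: nbhs_dnbhs_neq.
  rewrite /= !QE mulmxDl -scalemxAl !dotvE /k /l /GRing.scale /=.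
  by field.
have kl : 0 * k + l = l by rewrite mul0r add0r.
rewrite -[X in _ --> X]kl; apply: cvgD; last exact: cvg_cst.
by apply: cvgM; [exact: cvg_within | exact: cvg_cst].
Unshelve. all: by end_near. Qed.

Lemma grad_add f Q r : (forall x, f x = Q x + r x) ->
  (forall x, differentiable Q x) -> (forall x, differentiable r x) ->
  forall x, grad f x = grad Q x + grad r x.
Proof.
move=> fE dQ dr x; have -> : f = Q + r by apply/funext => y; rewrite fE.
by apply/rowP => i; rewrite !mxE deriveD //; exact: diff_derivable.
Qed.

Section DeviceMean.
Context {M : nat}.
Hypothesis M0 : (0 < M)%N.
Implicit Type F : 'I_M -> 'rV[R]_d.

Let MR0 : M%:R != 0 :> R.
Proof. by rewrite pnatr_eq0 -lt0n. Qed.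

Lemma dotv_mean F w : dotv (device_mean F) w = M%:R^-1 * \sum_m dotv (F m) w.
Proof. by rewrite /device_mean dotvZl dotv_suml. Qed.

Lemma device_meanD F F' :
  device_mean (fun m => F m + F' m) = device_mean F + device_mean F'.
Proof. by rewrite /device_mean big_split scalerDr. Qed.

Lemma device_mean_cst w : device_mean (fun _ : 'I_M => w) = w.
Proof.
rewrite /device_mean sumr_const card_ord -[w *+ M]scaler_nat.
by rewrite scalerA mulVf ?scale1r.
Qed.

Lemma device_meanB_cst F w : device_mean (fun m => F m - w) = device_mean F - w.
Proof. by rewrite device_meanD device_mean_cst. Qed.

Lemma device_mean_mulmx F (B : 'M[R]_d) :
  device_mean (fun m => F m *m B) = device_mean F *m B.
Proof. by rewrite /device_mean -scalemxAl mulmx_suml. Qed.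

Lemma dotv_mean_le F :
  dotv (device_mean F) (device_mean F) <= M%:R^-1 * \sum_m dotv (F m) (F m).
Proof.
rewrite /device_mean dotvZl dotvZr ler_wpM2l ?invr_ge0 //.
by rewrite ler_pdivrMl ?ltr0n // dotv_sum_le.
Qed.

Lemma device_mean_grad_quadratic Q F : quadratic Q ->
  device_mean (fun m => grad Q (F m)) = grad Q (device_mean F).
Proof.
move=> /quadratic_grad[B [b QE]].
have -> : (fun m => grad Q (F m)) = (fun m => F m *m B + b).
  by apply/funext => m; rewrite QE.
by rewrite device_meanD device_mean_mulmx device_mean_cst QE.
Qed.

Variables (f Q r : 'rV[R]_d -> R) (L LR gamma : R) (xs : 'rV[R]_d).
Hypothesis L0 : 0 < L.
Hypothesis fE : forall x, f x = Q x + r x.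
Hypothesis quadQ : quadratic Q.
Hypothesis cQ : strongly_convex 0 Q.
Hypothesis cr : strongly_convex 0 r.
Hypothesis sr : smooth LR r.
Hypothesis sf : smooth L f.
Hypothesis fmin : forall x, f xs <= f x.

Let gradE x : grad f x = grad Q x + grad r x.
Proof. by apply: grad_add => //; [case: cQ | case: cr]. Qed.

Lemma bregman_add y x : bregman f y x = bregman Q y x + bregman r y x.
Proof. by rewrite /bregman gradE !fE dotvDl; ring. Qed.

(** The remainder inherits the smoothness constant of the sum, because the
    quadratic part is convex. *)
Lemma remainder_smooth : smooth L r.
Proof.
split; first by case: cr.
move=> x y; have := bregman_le y x sf; rewrite sqr_enorm bregman_add.
by apply: le_trans; rewrite lerDr bregman_ge0.
Qed.

Lemma sum_convex : strongly_convex 0 f.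
Proof.
split; first by case: sf.
move=> x y; rewrite !mul0r -/(bregman f y x) bregman_add.
by rewrite addr_ge0 ?bregman_ge0.
Qed.

Variable x : 'I_M -> 'rV[R]_d.
Let xb := device_mean x.
Let G := device_mean (fun m => grad f (x m)).
Let S := M%:R^-1 * \sum_m dotv (x m - xb) (x m - xb).

Let meanG : G = grad Q xb + device_mean (fun m => grad r (x m)).
Proof.
rewrite /G -device_mean_grad_quadratic // -device_meanD; congr device_mean.
by apply/funext => m; rewrite gradE.
Qed.

(** Since the gradient of the quadratic part commutes with averaging, only the
    remainder contributes to the bias of the averaged gradient. *)
Lemma mean_gradient_dot : f xb - f xs - LR / 2 * S <= dotv G (xb - xs).
Proof.
rewrite meanG dotvDl dotv_mean.
have q : Q xb - Q xs <= dotv (grad Q xb) (xb - xs).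
  by have := bregman_ge0 xs xb cQ; rewrite /bregman -[xs - xb]opprB dotvNr; lra.
have rm m : r xb - r xs - LR / 2 * dotv (x m - xb) (x m - xb) <=
    dotv (grad r (x m)) (xb - xs).
  have -> : xb - xs = (xb - x m) - (xs - x m).
    by apply/rowP => i; rewrite !mxE; ring.
  rewrite [dotv (grad r _) _]dotvDr dotvNr.
  have := bregman_ge0 xs (x m) cr; have := bregman_le xb (x m) sr.
  rewrite /bregman; lra.
have -> : f xb - f xs - LR / 2 * S = (Q xb - Q xs) +
    M%:R^-1 * \sum_m (r xb - r xs - LR / 2 * dotv (x m - xb) (x m - xb)).
  rewrite !fE sumrB sumr_const card_ord -mulr_sumr.
  rewrite -[(_ - _) *+ M]mulr_natl mulrBr.
  by rewrite mulKf // /S; ring.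
by rewrite lerD // ler_wpM2l ?invr_ge0 // ler_sum.
Qed.

Lemma mean_gradient_sqr :
  dotv G G <= 4 * L * (f xb - f xs) + 2 * L * LR * S.
Proof.
pose e := device_mean (fun m => grad r (x m) - grad r xb).
have -> : G = grad f xb + e.
  rewrite meanG gradE /e device_meanB_cst.
  by apply/rowP => i; rewrite !mxE; ring.
have gf := sqr_grad_le xb L0 sf fmin.
have ee : dotv e e <= L * LR * S.
  apply: (le_trans (dotv_mean_le _)).
  rewrite /S mulrCA ler_wpM2l ?invr_ge0 // mulr_sumr ler_sum // => m _.
  apply: (le_trans (cocoercive (x m) xb L0 cr remainder_smooth)).
  have := bregman_le (x m) xb sr.
  have -> : xb - x m = - (x m - xb) by rewrite opprB.
  rewrite dotvNl dotvNr opprK -(ler_pM2l L0); lra.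
have := dotv_le (grad f xb) e.
rewrite dotvDl !dotvDr (dotvC e); lra.
Qed.

Lemma mean_descent : 0 <= gamma -> gamma * (6 * L) <= 1 ->
  dotv (xb - gamma *: G - xs) (xb - gamma *: G - xs) +
    4 / 3 * gamma * (f xb - f xs) <=
  dotv (xb - xs) (xb - xs) + 4 / 3 * gamma * LR * S.
Proof.
move=> g0 gL.
have LRS : 0 <= LR * S.
  rewrite /S mulrCA mulr_ge0 ?invr_ge0 // mulr_sumr sumr_ge0 // => m _.
  have := le_trans (bregman_ge0 xb (x m) cr) (bregman_le xb (x m) sr); lra.
have d0 : 0 <= f xb - f xs by rewrite subr_ge0.
have h1 := mean_gradient_dot; have h2 := mean_gradient_sqr.
have -> : xb - gamma *: G - xs = (xb - xs) - gamma *: G by rewrite addrAC.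
move: h1 h2; move: (xb - xs) (G) => u g h1 h2.
rewrite !dotvE (dotvC u g).
have h1' := ler_wpM2l g0 h1.
have h2' := ler_wpM2l (mulr_ge0 g0 g0) h2.
(* As [gamma L <= 1 / 6], the terms of order [gamma ^ 2] use up a third of the
   gain [2 gamma (f xb - f xs)] and add a third to the consensus term. *)
have k1 := ler_wpM2r (mulr_ge0 g0 d0) gL.
have k2 := ler_wpM2r (mulr_ge0 g0 LRS) gL.
nra.
Qed.

End DeviceMean.

(** The consensus error around the mean is at most the mean pairwise one. *)
Lemma mean_consensus_le M (x : 'I_M -> 'rV[R]_d) : (0 < M)%N ->
  \sum_m dotv (x m - device_mean x) (x m - device_mean x) <=
  M%:R^-1 * \sum_m \sum_j dotv (x m - x j) (x m - x j).
Proof.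
move=> M0; rewrite mulr_sumr ler_sum // => m _.
have -> : x m - device_mean x = device_mean (fun j => x m - x j).
  rewrite device_meanD device_mean_cst //; congr (_ + _).
  by rewrite /device_mean sumrN scalerN.
exact: dotv_mean_le.
Qed.

Lemma convex_mean_le f n (y : 'I_n -> 'rV[R]_d) : (0 < n)%N ->
  strongly_convex 0 f -> f (device_mean y) <= n%:R^-1 * \sum_i f (y i).
Proof.
move=> n0 cf; set yb := device_mean y.
have n0' : n%:R != 0 :> R by rewrite pnatr_eq0 -lt0n.
have -> : f yb = n%:R^-1 * \sum_i (f yb + dotv (grad f yb) (y i - yb)).
  rewrite big_split /= sumr_const card_ord -[f yb *+ n]mulr_natl.
  rewrite mulrDr mulKf //.
  rewrite -dotv_sumr -dotvZr -/(device_mean (fun i => y i - yb)).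
  by rewrite device_meanB_cst // subrr dotvC dotv0l addr0.
rewrite ler_wpM2l ?invr_ge0 // ler_sum // => i _.
have := bregman_ge0 (y i) yb cf; rewrite /bregman; lra.
Qed.

End Decomposition.

(** * Measurability in the iterate and in the draw *)

(** A vector-valued function is measurable when its coordinates are. *)
Definition measurable_vec (R : realType) (d : nat) (dW : measure_display)
    (W : measurableType dW) (y : W -> 'rV[R]_d) : Prop :=
  forall i, measurable_fun [set: W] (fun w => y w 0 i).

Section MeasurableVectors.
Context {R : realType} {d : nat} {dW : measure_display} {W : measurableType dW}.
Implicit Types (u v y : W -> 'rV[R]_d).

Lemma measurable_vec_cst (c : 'rV[R]_d) : measurable_vec (fun _ : W => c).
Proof. by move=> i; exact: measurable_cst. Qed.

Lemma measurable_vecD u v : measurable_vec u -> measurable_vec v ->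
  measurable_vec (fun w => u w + v w).
Proof.
move=> mu mv i; under eq_fun do rewrite mxE.
exact: measurable_funD.
Qed.

Lemma measurable_vecZ a u : measurable_vec u ->
  measurable_vec (fun w => a *: u w).
Proof.
move=> mu i; under eq_fun do rewrite mxE.
exact: measurable_funM.
Qed.

Lemma measurable_vecB u v : measurable_vec u -> measurable_vec v ->
  measurable_vec (fun w => u w - v w).
Proof.
move=> mu mv; under eq_fun do rewrite -scaleN1r.
by apply: measurable_vecD => //; exact: measurable_vecZ.
Qed.

Lemma measurable_vec_sum (I : eqType) (s : seq I) (u : I -> W -> 'rV[R]_d) :
  (forall i, i \in s -> measurable_vec (u i)) ->
  measurable_vec (fun w => \sum_(i <- s) u i w).
Proof.
elim: s => [|i s IH] mu.
  by under eq_fun do rewrite big_nil; exact: measurable_vec_cst.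
under eq_fun do rewrite big_cons; apply: measurable_vecD.
  by apply: mu; rewrite mem_head.
by apply: IH => j js; apply: mu; rewrite inE js orbT.
Qed.

Lemma measurable_vec_mean M (u : W -> 'I_M -> 'rV[R]_d) :
  (forall m, measurable_vec (u^~ m)) ->
  measurable_vec (fun w => device_mean (u w)).
Proof. by move=> mu; apply: measurable_vecZ; apply: measurable_vec_sum. Qed.

Lemma measurable_dotv u v : measurable_vec u -> measurable_vec v ->
  measurable_fun [set: W] (fun w => dotv (u w) (v w)).
Proof.
by move=> mu mv; apply: measurable_sum => i; exact: measurable_funM.
Qed.

Let grid (n : nat) (q : 'rV[int]_d) : 'rV[R]_d :=
  \row_i ((q 0 i)%:~R / n.+1%:R).

Let round (n : nat) (x : 'rV[R]_d) : 'rV[int]_d :=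
  \row_i Num.floor (n.+1%:R * x 0 i).

Let cvg_grid x : grid n (round n x) @[n --> \oo] --> x.
Proof.
apply/cvg_ballP => e e0.
have := @cvg_harmonic R.
move=> /cvgrPdist_lt /(_ _ e0); apply: filterS => n.
rewrite sub0r normrN /= ger0_norm ?invr_ge0 // => ne.
split => // i j; rewrite (ord1 i) !mxE.
have /andP[f1 f2] := floor_itv (n.+1%:R * x 0 j).
rewrite /ball /= ger0_norm; last first.
  by rewrite subr_ge0 ler_pdivrMr ?ltr0n // (mulrC (x 0 j)).
apply: lt_trans ne.
rewrite -(ltr_pM2l (ltr0Sn R n)) mulrBr divff ?pnatr_eq0 //.
rewrite mulrCA divff ?pnatr_eq0 // mulr1.
by rewrite intrD in f2; rewrite ltrBlDl.
Qed.

(** Caratheodory functions are jointly measurable: the argument is rounded to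
    a grid, on which only countably many values occur. *)
Lemma measurable_caratheodory (G : 'rV[R]_d -> W -> R) y :
  (forall x, measurable_fun [set: W] (G x)) ->
  (forall w, continuous (G^~ w)) -> measurable_vec y ->
  measurable_fun [set: W] (fun w => G (y w) w).
Proof.
move=> mG cG my.
apply: (@measurable_fun_cvg _ _ R _ (fun n w => G (grid n (round n (y w))) w)).
  move=> n _ B mB; rewrite setTI.
  have -> : (fun w => G (grid n (round n (y w))) w) @^-1` B =
      \bigcup_q ((fun w => round n (y w)) @^-1` [set q]
                 `&` G (grid n q) @^-1` B).
    apply/seteqP; split => [w Bw|w [q _ [/= <-]] //].
    by exists (round n (y w)).
  apply: countable_bigcupT_measurable => [|q]; first exact: countableP.
  apply: measurableI; last by rewrite -[X in measurable X]setTI; exact: mG.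
  have -> : (fun w => round n (y w)) @^-1` [set q] =
      \bigcap_(i in [set: 'I_d])
        ((fun w => n.+1%:R * y w 0 i) @^-1`
          `[(q 0 i)%:~R, (q 0 i + 1)%:~R[%classic).
    apply/seteqP; split => [w /= <- i _|w /= wq].
      by rewrite /= in_itv /= mxE floor_itv.
    apply/rowP => i; rewrite mxE; apply: floor_def.
    by have := wq i I; rewrite /= in_itv.
  apply: fin_bigcap_measurable => // i _.
  have mi : measurable_fun [set: W] (fun w => n.+1%:R * y w 0 i).
    exact: measurable_funM.
  by rewrite -[X in measurable X]setTI; apply: mi => //; exact: measurable_itv.
move=> w _.
pose g n := grid n (round n (y w)).
have cg : g @ \oo --> y w by exact: cvg_grid.
exact: (cvg_comp g (G^~ w) cg (cG w (y w))).
Qed.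

Lemma measurable_grad (G : 'rV[R]_d -> W -> R) y :
  (forall x, measurable_fun [set: W] (G x)) ->
  (forall w x, differentiable (G^~ w) x) -> measurable_vec y ->
  measurable_vec (fun w => grad (G^~ w) (y w) : 'rV[R]_d).
Proof.
move=> mG dG my i; under eq_fun do rewrite mxE.
have cG w : continuous (G^~ w).
  by move=> x; apply: differentiable_continuous.
set e := delta_mx 0 i.
apply: (@measurable_fun_cvg _ _ R _ (fun n w =>
   n.+1%:R^-1^-1 * (G (n.+1%:R^-1 *: e + y w) w - G (y w) w))).
  move=> n; apply: measurable_funM => //; apply: measurable_funB.
    apply: (@measurable_caratheodory G (fun w => n.+1%:R^-1 *: e + y w)) => //.
    by apply: measurable_vecD => //; exact: measurable_vec_cst.
  exact: measurable_caratheodory.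
move=> w _.
have : derivable (G^~ w) (y w) e by exact: diff_derivable.
move=> /cvgr_dnbhsP; apply.
by split; [move=> n; rewrite invr_eq0 pnatr_eq0 | exact: cvg_harmonic].
Qed.

Section Iterates.
Context {Z : Type} {M : nat}.
Variables (F : 'rV[R]_d -> Z -> R) (H : nat) (gamma : nat -> R).
Variables (x0 : 'rV[R]_d) (zs : nat -> 'I_M -> W -> Z).
Hypothesis dF : forall z x, differentiable (F^~ z) x.

Lemma measurable_sgrad (z : W -> Z) y :
  (forall x, measurable_fun [set: W] (F x \o z)) -> measurable_vec y ->
  measurable_vec (fun w => sgrad F (y w) (z w)).
Proof. by move=> mF my; apply: (@measurable_grad (fun x w => F x (z w))). Qed.

(** The iterates up to time [t] depend measurably on the draws before [t]. *)
Lemma measurable_local_sgd t :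
  (forall s m, (s < t)%N ->
     forall x, measurable_fun [set: W] (F x \o zs s m)) ->
  forall m, measurable_vec
    (fun w => local_sgd F H gamma x0 (fun s j => zs s j w) t m).
Proof.
elim: t => [|t IH] mz m /=; first exact: measurable_vec_cst.
have mx j : measurable_vec
    (fun w => local_sgd F H gamma x0 (fun s j => zs s j w) t j).
  by apply: IH => s k st; apply: mz; rewrite ltnS ltnW.
have my j : measurable_vec (fun w =>
    local_sgd F H gamma x0 (fun s j => zs s j w) t j -
    gamma t *: sgrad F (local_sgd F H gamma x0 (fun s j => zs s j w) t j)
                     (zs t j w)).
  apply: measurable_vecB => //; apply: measurable_vecZ.
  by apply: measurable_sgrad => // x; exact: mz.
by case: (H %| t.+1)%N; [exact: measurable_vec_mean | exact: my].
Qed.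

End Iterates.

End MeasurableVectors.

(** * Independence and freezing *)

Section Freezing.
Context {R : realType} {dO dZ : measure_display} {Omega : measurableType dO}
  {Z : measurableType dZ} (P : probability Omega R) (D : probability Z R)
  {I : finType} (X : I -> {RV P >-> Z}).

(** Cylinders that constrain every variable but [X k]. *)
Definition cylinders_but (k : I) : set (set Omega) :=
  [set A | exists2 B : I -> set Z, (forall i, measurable (B i)) &
           A = \bigcap_(i in [set i | i != k]) (X i @^-1` B i)].

(** The sample space with the sigma-algebra generated by all the variables
    but [X k]. *)
Definition others (k : I) := g_sigma_algebraType (cylinders_but k).

Hypothesis indep : mutually_independent X.
Hypothesis law : forall i B, measurable B -> distribution P (X i) B = D B.
Variable k : I.

Lemma measurable_others i : i != k ->
  measurable_fun [set: others k] (X i : others k -> Z).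
Proof.
move=> ik _ B mB; rewrite setTI; apply: sub_sigma_algebra.
exists (fun j => if j == i then B else setT).
  by move=> j; case: ifP.
apply/seteqP; split => [w XB j _ /=|w /(_ i ik) /=]; last by rewrite eqxx.
by case: eqP => [->|].
Qed.

Lemma cylinders_but_measurable : cylinders_but k `<=` measurable.
Proof.
move=> _ [B mB ->]; apply: fin_bigcap_measurable => [|i _].
  exact: finite_finset.
by rewrite -[Y in measurable Y]setTI; exact: measurable_funP.
Qed.

Lemma others_measurable (A : set (others k)) :
  measurable A -> measurable (A : set Omega).
Proof.
apply: (smallest_sub (@sigma_algebra_measurable _ Omega)).
exact: cylinders_but_measurable.
Qed.

Lemma cylinders_but_setI : setI_closed (cylinders_but k).
Proof.
move=> _ _ [B mB ->] [C mC ->]; exists (fun i => B i `&` C i).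
  by move=> i; exact: measurableI.
by rewrite -bigcapI.
Qed.

Lemma cylinders_but_indep A C : cylinders_but k A -> measurable C ->
  P (A `&` X k @^-1` C) = (P A * D C)%E.
Proof.
move=> [B mB ->] mC.
have gen C' : measurable C' ->
    P ((\bigcap_(i in [set i | i != k]) (X i @^-1` B i)) `&` X k @^-1` C') =
    (D C' * \prod_(i | i != k) P (X i @^-1` B i))%E.
  move=> mC'; pose B' i := if i == k then C' else B i.
  have mB' i : i \in [set: I]%SET -> measurable (B' i).
    by move=> _; rewrite /B'; case: ifP.
  transitivity (P (\bigcap_(i in [set` [set: I]%SET]) (X i @^-1` B' i))).
    congr (P _); apply/seteqP; split => [w [wB wC] i _|w wB].
      by rewrite /B' /=; case: (eqVneq i k) => [->|/wB].
    split => [i /= ik|].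
      by have := wB i; rewrite /B' /= inE (negbTE ik); apply.
    by have := wB k; rewrite /B' /= inE eqxx; apply.
  rewrite indep // (bigD1 k) /=; last by rewrite inE.
  rewrite {1}/B' eqxx -(law k) //; congr (_ * _)%E.
  apply: eq_big => [i|i /andP[_ ik]]; first by rewrite inE.
  by rewrite /B' (negbTE ik).
rewrite gen //.
(* With no constraint on [X k], [gen] gives the probability of the cylinder. *)
have := gen setT measurableT; rewrite preimage_setT setIT => ->.
by rewrite probability_setT mul1e muleC.
Qed.

Lemma others_indep (A : set (others k)) C : measurable A -> measurable C ->
  P (A `&` X k @^-1` C) = (P A * D C)%E.
Proof.
move=> mA mC.
have mXC : measurable (X k @^-1` C).
  by rewrite -[Y in measurable Y]setTI; exact: measurable_funP.
have DC0 : 0 <= fine (D C) by rewrite fine_ge0.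
pose m1 : {measure set Omega -> \bar R} := mrestr P mXC.
pose m2 : {measure set Omega -> \bar R} := mscale (NngNum DC0) P.
have DCE : ((fine (D C))%:E = D C)%E by rewrite fineK // fin_num_measure.
have -> : P (A `&` X k @^-1` C) = m1 A by [].
have -> : (P A * D C)%E = m2 A by rewrite /m2 /= /mscale /= DCE muleC.
apply: (@g_sigma_algebra_measure_unique _ _ _ (cylinders_but k)
  cylinders_but_measurable (fun=> setT)) => //.
- move=> _; exists (fun=> setT) => //.
  by apply/esym; rewrite -subTset => w _ i _.
- by apply/seteqP; split => // w _; exists 0%N.
- exact: cylinders_but_setI.
- move=> B cB; rewrite /m1 /m2 /= /mrestr /mscale /= DCE.
  by rewrite cylinders_but_indep // muleC.
- move=> _; rewrite /m1 /= /mrestr setTI.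
  exact: le_lt_trans (probability_le1 _ mXC) (ltry _).
Qed.

(** By independence, the variables other than [X k] can be held fixed while
    [X k] is integrated out. *)
Lemma freezing (h : Omega -> Z -> R) :
  measurable_fun [set: others k * Z] (fun p : others k * Z => h p.1 p.2) ->
  (forall w z, 0 <= h w z) ->
  (\int[P]_w (h w (X k w))%:E = \int[P]_w \int[D]_z (h w z)%:E)%E.
Proof.
move=> mh h0.
have mid : measurable_fun [set: Omega] (id : Omega -> others k).
  by move=> _ A mA; rewrite setTI; exact: others_measurable.
pose phi (w : Omega) : others k * Z := (w, X k w).
have mphi : measurable_fun [set: Omega] phi by exact: measurable_fun_pair.
pose idm := isMeasurableFun.Build _ _ _ _ _ mid.
pose idf : {mfun Omega >-> others k} := HB.pack (id : Omega -> others k) idm.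
pose phm := isMeasurableFun.Build _ _ _ _ _ mphi.
pose phf : {mfun Omega >-> (others k * Z)%type} := HB.pack phi phm.
pose Po : probability (others k) R := distribution P idf.
pose Pj : probability (others k * Z)%type R := distribution P phf.
have PjE A : measurable A -> (Po \x D)%E A = Pj A.
  apply: product_measure_unique => B C mB mC.
  rewrite /Pj /Po /= /distribution /pushforward /=.
  by rewrite -[RHS]others_indep.
pose f (p : others k * Z) := (h p.1 p.2)%:E.
have mf : measurable_fun setT f by exact/measurable_EFinP.
have f0 p : (0 <= f p)%E by rewrite lee_fin.
transitivity (\int[Pj]_p f p)%E.
  by rewrite ge0_integral_distribution.
transitivity (\int[Po \x D]_p f p)%E.
  by apply: eq_measure_integral => A mA _; apply/esym/PjE.
rewrite (fubini_tonelli1 f mf f0).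
rewrite ge0_integral_distribution //.
  exact: measurable_fun_fubini_tonelli_F.
by move=> w; exact: integral_ge0.
Qed.

Lemma freezing_le (h : Omega -> Z -> R) (c : Omega -> R) :
  measurable_fun [set: others k * Z] (fun p : others k * Z => h p.1 p.2) ->
  (forall w z, 0 <= h w z) ->
  measurable_fun [set: Omega] c -> (forall w, 0 <= c w) ->
  (forall w, \int[D]_z (h w z)%:E <= (c w)%:E)%E ->
  (\int[P]_w (h w (X k w))%:E <= \int[P]_w (c w)%:E)%E.
Proof.
move=> mh h0 mc c0 hc; rewrite freezing //.
have mf : measurable_fun setT (fun p : others k * Z => (h p.1 p.2)%:E).
  exact/measurable_EFinP.
apply: ge0_le_integral => //.
- by move=> w _; apply: integral_ge0 => z _; rewrite lee_fin.
- have mF := @measurable_fun_fubini_tonelli_F _ _ _ _ _ D _ mf _.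
  move=> _ B mB; rewrite setTI; apply: others_measurable.
  rewrite -[Y in measurable Y]setTI; apply: mF => //.
  by move=> p; rewrite lee_fin.
- exact/measurable_EFinP.
Qed.

End Freezing.

(** * Mean squares *)

Section NonnegativeExpectation.
Context {R : realType} {dO : measure_display} {Omega : measurableType dO}
  (P : probability Omega R).
Implicit Types f g : Omega -> R.

Lemma expect_le f g :
  measurable_fun [set: Omega] f -> measurable_fun [set: Omega] g ->
  (forall w, 0 <= f w) -> (forall w, f w <= g w) ->
  (\int[P]_w (f w)%:E <= \int[P]_w (g w)%:E)%E.
Proof.
move=> mf mg f0 fg; apply: ge0_le_integral => //; try exact/measurable_EFinP.
- by move=> w _; rewrite lee_fin.
- by move=> w _; rewrite lee_fin.
Qed.

Lemma expectD f g :
  measurable_fun [set: Omega] f -> measurable_fun [set: Omega] g ->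
  (forall w, 0 <= f w) -> (forall w, 0 <= g w) ->
  (\int[P]_w (f w + g w)%:E = \int[P]_w (f w)%:E + \int[P]_w (g w)%:E)%E.
Proof.
move=> mf mg f0 g0; under eq_integral do rewrite EFinD.
by apply: ge0_integralD => // *; rewrite ?lee_fin //; exact/measurable_EFinP.
Qed.

Lemma expect_cst a : (\int[P]_w a%:E = a%:E)%E.
Proof. by rewrite integral_cst //= probability_setT mule1. Qed.

Lemma expectZ a f : 0 <= a -> measurable_fun [set: Omega] f ->
  (forall w, 0 <= f w) ->
  (\int[P]_w (a * f w)%:E = a%:E * \int[P]_w (f w)%:E)%E.
Proof.
move=> a0 mf f0; under eq_integral do rewrite EFinM.
by apply: ge0_integralZl_EFin => // *; rewrite ?lee_fin //;
  exact/measurable_EFinP.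
Qed.

Lemma expect_sum_le (I : Type) (s : seq I) (f : I -> Omega -> R) (a : I -> R) :
  (forall i, measurable_fun [set: Omega] (f i)) -> (forall i w, 0 <= f i w) ->
  (forall i, \int[P]_w (f i w)%:E <= (a i)%:E)%E ->
  (\int[P]_w (\sum_(i <- s) f i w)%R%:E <= (\sum_(i <- s) a i)%R%:E)%E.
Proof.
move=> mf f0 fa.
under eq_integral do rewrite -sumEFin.
rewrite ge0_integral_sum //.
- by rewrite -sumEFin; apply: lee_sum.
- by move=> i; exact/measurable_EFinP.
- by move=> i w _; rewrite lee_fin.
Qed.

End NonnegativeExpectation.

(** A centred perturbation adds at most its variance to the mean square. *)
Lemma centred_perturbation (R : realType) (d : nat) (dZ : measure_display)
    (Z : measurableType dZ) (D : probability Z R) (N : Z -> 'rV[R]_d)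
    (u : 'rV[R]_d) (a s : R) :
  measurable_vec N ->
  (forall i, \int[D]_z (N z 0 i)%:E = 0)%E ->
  (\int[D]_z (dotv (N z) (N z))%:E <= s%:E)%E ->
  (\int[D]_z (dotv (u + a *: N z) (u + a *: N z))%:E <=
   (dotv u u + a ^+ 2 * s)%:E)%E.
Proof.
move=> mN N0 Ns.
have iN i : D.-integrable setT (EFin \o (fun z => N z 0 i)).
  apply/integrableP; split; first by apply/measurable_EFinP; exact: mN.
  by rewrite (integral_fin_num_abs _ _ (mN i)) // N0.
have mNN : measurable_fun [set: Z] (fun z => dotv (N z) (N z)).
  exact: measurable_dotv.
have iNN : D.-integrable setT (EFin \o (fun z => dotv (N z) (N z))).
  apply/integrableP; split; first exact/measurable_EFinP.
  rewrite (eq_integral (fun z => (dotv (N z) (N z))%:E)).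
    exact: le_lt_trans Ns (ltry _).
  by move=> z _ /=; rewrite ger0_norm ?dotvv_ge0.
have E z : (dotv (u + a *: N z) (u + a *: N z))%:E =
    ((dotv u u)%:E + (\sum_i (2 * a * u 0 i)%:E * (N z 0 i)%:E)
     + (a ^+ 2)%:E * (dotv (N z) (N z))%:E)%E.
  under eq_bigr do rewrite -EFinM.
  rewrite sumEFin -EFinM -!EFinD; congr EFin.
  rewrite !dotvE (dotvC (N z) u).
  have -> : \sum_i 2 * a * u 0 i * N z 0 i = 2 * a * dotv u (N z).
    by rewrite /dotv mulr_sumr; apply: eq_bigr => i _; rewrite mulrA.
  ring.
have iZ i : D.-integrable setT (fun z => (2 * a * u 0 i)%:E * (N z 0 i)%:E)%E.
  exact: (integrableZl measurableT (2 * a * u 0 i) (iN i)).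
rewrite (eq_integral _ _ (fun z _ => E z)) integralD //; last 2 first.
- apply: integrableD => //; last exact: integrable_sum.
  exact: finite_measure_integrable_cst.
- exact: integrableZl.
rewrite integralD //; last 2 first.
- exact: finite_measure_integrable_cst.
- exact: integrable_sum.
rewrite integral_cst //= probability_setT mule1 integral_sum //.
rewrite big1; last first.
  move=> i _; rewrite (integralZl measurableT (iN i)).
  by rewrite [X in (_ * X)%E](N0 i) mule0.
rewrite adde0 integralZl // EFinD leeD2l // (EFinM (a ^+ 2)) lee_wpmul2l //.
by rewrite lee_fin sqr_ge0.
Qed.

(** * The stochastic process *)

(** The case where the devices always agree: one local step per round, or a
    single device. *)
Definition no_drift (M H : nat) : bool := (H == 1)%N || (M == 1)%N.

Section LocalSGD.
Context {R : realType} {d M H T : nat} {dZ dO : measure_display}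
  {Z : measurableType dZ} {Omega : measurableType dO}
  (D : probability Z R) (P : probability Omega R) (F : 'rV[R]_d -> Z -> R)
  (sigma gamma : R) (x0 : 'rV[R]_d) (z : nat -> 'I_M -> {RV P >-> Z}).

Local Notation f := (objective D F).
Local Notation draw := (fun k : 'I_T * 'I_M => z k.1 k.2).

Hypothesis M0 : (0 < M)%N.
Hypothesis stochF : stochastic_function D F.
Hypothesis oracle : stochastic_oracle D F sigma 0.
Hypothesis iid : iid_draws D T z.
Hypothesis df : forall x, differentiable f x.

(** The iterate of device [m] at time [t], as a random vector. *)
Definition iterate (t : nat) (m : 'I_M) (w : Omega) : 'rV[R]_d :=
  local_sgd F H (fun=> gamma) x0 (fun s j => z s j w) t m.

(** The gradient noise of device [m] at time [t]. *)
Definition noise (t : nat) (m : 'I_M) (w : Omega) : 'rV[R]_d :=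
  sgrad F (iterate t m w) (z t m w) - grad f (iterate t m w).

Lemma measurable_stochastic_function x : measurable_fun [set: Z] (F x).
Proof.
by apply/measurable_EFinP; have := stochF.1 x; move=> /integrableP[].
Qed.

Lemma measurable_grad_objective (dW : measure_display) (W : measurableType dW)
    (y : W -> 'rV[R]_d) :
  measurable_vec y -> measurable_vec (fun w => grad f (y w)).
Proof.
by move=> my; apply: (@measurable_grad _ _ _ _ (fun x _ => f x)).
Qed.

Lemma measurable_objective (dW : measure_display) (W : measurableType dW)
    (y : W -> 'rV[R]_d) :
  measurable_vec y -> measurable_fun [set: W] (fun w => f (y w)).
Proof.
move=> my; apply: (@measurable_caratheodory _ _ _ _ (fun x _ => f x)) => //.
by move=> _ x; exact: differentiable_continuous.
Qed.

Lemma measurable_draw (dW : measure_display) (W : measurableType dW)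
    (g : W -> Z) : measurable_fun [set: W] g ->
  forall x, measurable_fun [set: W] (F x \o g).
Proof.
by move=> mg x; exact: (measurableT_comp (measurable_stochastic_function x)).
Qed.

Lemma measurable_iterate t m : measurable_vec (iterate t m).
Proof.
apply: measurable_local_sgd; first by case: stochF.
by move=> s j _; apply: measurable_draw.
Qed.

Section OneStep.
Variable t : nat.
Hypothesis tT : (t < T)%N.

(* The index of the draw of device [m] at time [t]. *)
Let key m : 'I_T * 'I_M := (Ordinal tT, m).

Lemma measurable_iterate_others m j :
  measurable_vec (iterate t j : others draw (key m) -> _).
Proof.
apply: measurable_local_sgd; first by case: stochF.
move=> s i st; apply: measurable_draw.
have sT := ltn_trans st tT.
apply: (@measurable_others _ _ _ _ _ _ _ draw (key m) (Ordinal sT, i)).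
by rewrite /key xpair_eqE -val_eqE /= ltn_eqF.
Qed.

Lemma measurable_noise_others m j : j != m ->
  measurable_vec (noise t j : others draw (key m) -> _).
Proof.
move=> jm; apply: measurable_vecB; last first.
  by apply: measurable_grad_objective; exact: measurable_iterate_others.
apply: measurable_sgrad; [by case: stochF | | exact: measurable_iterate_others].
apply: measurable_draw.
apply: (@measurable_others _ _ _ _ _ _ _ draw (key m) (key j)).
by rewrite /key xpair_eqE eqxx.
Qed.

Lemma oracle_perturbation x u a :
  (\int[D]_y (dotv (u + a *: (sgrad F x y - grad f x))
                   (u + a *: (sgrad F x y - grad f x)))%:E <=
   (dotv u u + a ^+ 2 * sigma ^+ 2)%:E)%E.
Proof.
have [_ _ mean var] := oracle.
have ms : measurable_vec (fun y : Z => sgrad F x y).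
  apply: measurable_sgrad => [|x'|]; first by case: stochF.
    exact: measurable_stochastic_function.
  exact: measurable_vec_cst.
apply: (@centred_perturbation _ _ _ _ D (fun y => sgrad F x y - grad f x)).
- by apply: measurable_vecB => //; exact: measurable_vec_cst.
- move=> i.
  have coord y : (sgrad F x y - grad f x) 0 i =
      sgrad F x y 0 i - grad f x 0 i.
    by rewrite !mxE.
  under eq_integral do rewrite coord EFinB.
  have mi := mean x i; rewrite unlock in mi.
  have ii : D.-integrable setT (EFin \o (fun y => sgrad F x y 0 i)).
    apply/integrableP; split; first by apply/measurable_EFinP; exact: ms.
    by rewrite (integral_fin_num_abs _ _ (ms i)) // mi.
  rewrite integralB //; last exact: finite_measure_integrable_cst.
  rewrite integral_cst //= probability_setT mule1.
  by rewrite [X in (X - _)%E]mi subee.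
- have := var x; rewrite mul0r addr0 unlock; apply: le_trans.
  rewrite le_eqVlt; apply/orP; left; apply/eqP; apply: eq_integral => y _.
  by rewrite sqr_enorm.
Qed.

Lemma noise_step m (U : Omega -> 'rV[R]_d) a :
  measurable_vec U -> measurable_vec (U : others draw (key m) -> _) ->
  (\int[P]_w (dotv (U w + a *: noise t m w) (U w + a *: noise t m w))%:E <=
   \int[P]_w (dotv (U w) (U w))%:E + (a ^+ 2 * sigma ^+ 2)%:E)%E.
Proof.
move=> mU mUo.
rewrite -(expect_cst P (a ^+ 2 * sigma ^+ 2)) -expectD //; last 3 first.
- exact: measurable_dotv.
- by move=> w; exact: dotvv_ge0.
- by move=> w; rewrite mulr_ge0 // sqr_ge0.
pose V w y := U w + a *: (sgrad F (iterate t m w) y - grad f (iterate t m w)).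
have mfst : measurable_fun [set: others draw (key m) * Z]
    (fst : others draw (key m) * Z -> others draw (key m)).
  exact: measurable_fst.
have lift (g : Omega -> 'rV[R]_d) :
    measurable_vec (g : others draw (key m) -> _) ->
    measurable_vec (fun p : others draw (key m) * Z => g p.1).
  by move=> mg i; exact: (measurableT_comp (mg i) mfst).
have mit := lift _ (@measurable_iterate_others m m).
apply: (@freezing_le _ _ _ _ _ P D _ draw iid.2 _ (key m)
  (fun w y => dotv (V w y) (V w y))
  (fun w => dotv (U w) (U w) + a ^+ 2 * sigma ^+ 2)).
- by move=> [s j] B mB; apply: iid.1.
- have mV : measurable_vec (fun p : others draw (key m) * Z => V p.1 p.2).
    apply: measurable_vecD; first exact: lift.
    apply: measurable_vecZ; apply: measurable_vecB.
      apply: measurable_sgrad => //; first by case: stochF.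
      by apply: measurable_draw; exact: measurable_snd.
    exact: measurable_grad_objective.
  exact: measurable_dotv.
- by move=> w y; exact: dotvv_ge0.
- by apply: measurable_funD; [exact: measurable_dotv | exact: measurable_cst].
- move=> w; apply: addr_ge0; first exact: dotvv_ge0.
  by rewrite mulr_ge0 // sqr_ge0.
- by move=> w; exact: oracle_perturbation.
Qed.

(** The noises of distinct devices at one time add at most the sum of their
    variances to the mean square: the draws are integrated out one at a time. *)
Lemma noise_sum (s : seq 'I_M) (a : 'I_M -> R) (u : Omega -> 'rV[R]_d) :
  uniq s -> measurable_vec u ->
  (forall j, measurable_vec (u : others draw (key j) -> _)) ->
  (\int[P]_w (dotv (u w + \sum_(j <- s) a j *: noise t j w)
                   (u w + \sum_(j <- s) a j *: noise t j w))%:E <=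
   \int[P]_w (dotv (u w) (u w))%:E +
     ((\sum_(j <- s) a j ^+ 2) * sigma ^+ 2)%:E)%E.
Proof.
move=> us mu muo; elim: s us => [_|m s IH /= /andP[ms us]].
  rewrite big_nil mul0r adde0.
  by under eq_integral do rewrite big_nil addr0.
have mn j : measurable_vec (noise t j).
  apply: measurable_vecB; last first.
    by apply: measurable_grad_objective; exact: measurable_iterate.
  apply: measurable_sgrad; [by case: stochF | | exact: measurable_iterate].
  exact: measurable_draw.
pose U w := u w + \sum_(j <- s) a j *: noise t j w.
under eq_integral => w _.
  rewrite big_cons (_ : u w + _ = U w + a m *: noise t m w); last first.
    by rewrite /U addrCA addrC.
  over.
apply: (le_trans (@noise_step m U (a m) _ _)).
- apply: measurable_vecD => //; apply: measurable_vec_sum => j _.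
  exact: measurable_vecZ.
- apply: measurable_vecD; first exact: muo.
  apply: measurable_vec_sum => j js; apply: measurable_vecZ.
  by apply: measurable_noise_others; apply: contraNneq ms => <-.
rewrite big_cons mulrDl EFinD addeCA [leLHS]addeC leeD2l //.
exact: IH.
Qed.

End OneStep.

Section Descent.
Variables (Q r : 'rV[R]_d -> R) (L LR : R) (xs : 'rV[R]_d).
Hypothesis H0 : (0 < H)%N.
Hypothesis L0 : 0 < L.
Hypothesis LR0 : 0 <= LR.
Hypothesis fE : forall x, f x = Q x + r x.
Hypothesis quadQ : quadratic Q.
Hypothesis cQ : strongly_convex 0 Q.
Hypothesis cr : strongly_convex 0 r.
Hypothesis sr : smooth LR r.
Hypothesis sf : smooth L f.
Hypothesis fmin : forall x, f xs <= f x.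
Hypothesis g0 : 0 <= gamma.
Hypothesis gL : gamma * (6 * L) <= 1.

Let cf : strongly_convex 0 f.
Proof. exact: (sum_convex fE cQ cr sf). Qed.

Lemma iterate_step t m w : ~~ (H %| t.+1)%N ->
  iterate t.+1 m w =
  iterate t m w - gamma *: grad f (iterate t m w) - gamma *: noise t m w.
Proof.
move=> Ht; rewrite {1}/iterate /= (negbTE Ht) -/(iterate t m w).
by rewrite -addrA -opprD -scalerDr /noise addrCA subrr addr0.
Qed.

Let noise_ge0 : 0 <= 2 * gamma ^+ 2 * sigma ^+ 2.
Proof. by apply: mulr_ge0; [apply: mulr_ge0|]; rewrite ?sqr_ge0. Qed.

(** Between two communication rounds, each step adds the variance of two
    noises to the distance between two devices. *)
Lemma pairwise_consensus t m j : (t <= T)%N -> m != j ->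
  (\int[P]_w (dotv (iterate t m w - iterate t j w)
                   (iterate t m w - iterate t j w))%:E <=
   (2 * gamma ^+ 2 * sigma ^+ 2 * (t %% H)%:R)%:E)%E.
Proof.
move=> + mj; elim: t => [_|t IH tT].
  under eq_integral do rewrite subrr dotv0l.
  by rewrite expect_cst mod0n mulr0n mulr0.
have [Ht|Ht] := boolP (H %| t.+1)%N.
  under eq_integral do rewrite /iterate /= Ht subrr dotv0l.
  by rewrite expect_cst lee_fin mulr_ge0.
pose a i := if i == m then - gamma else gamma.
pose g i w := iterate t i w - gamma *: grad f (iterate t i w).
have stepE w : iterate t.+1 m w - iterate t.+1 j w =
    (g m w - g j w) + \sum_(i <- [:: m; j]) a i *: noise t i w.
  rewrite !iterate_step // !big_cons big_nil addr0 /a eqxx.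
  rewrite eq_sym (negbTE mj) scaleNr /g opprB.
  by apply/rowP => i; rewrite !mxE; ring.
under eq_integral do rewrite stepE.
have mg (dW : measure_display) (W : measurableType dW) (y : W -> 'rV[R]_d) :
    measurable_vec y ->
    measurable_vec (fun w => y w - gamma *: grad f (y w)).
  move=> my; apply: measurable_vecB => //; apply: measurable_vecZ.
  exact: measurable_grad_objective.
apply: (le_trans (@noise_sum _ tT [:: m; j] a (fun w => g m w - g j w) _ _ _)).
- by rewrite /= inE mj.
- by apply: measurable_vecB; apply: mg; exact: measurable_iterate.
- by move=> k; apply: measurable_vecB; apply: mg;
    exact: measurable_iterate_others.
rewrite modnS (negbTE Ht) !big_cons big_nil /a eqxx eq_sym (negbTE mj).
rewrite -[(t %% H).+1%:R]natr1 mulrDr mulr1 EFinD.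
apply: leeD; last by rewrite lee_fin sqrrN addr0; lra.
apply: le_trans (IH (ltnW tT)).
apply: expect_le => [| |w|w].
- by apply: measurable_dotv; apply: measurable_vecB; apply: mg;
    exact: measurable_iterate.
- by apply: measurable_dotv; apply: measurable_vecB; exact: measurable_iterate.
- exact: dotvv_ge0.
- apply: (gradient_step_nonexpansive _ _ L0 g0 _ cf sf).
  by move: gL; rewrite mulrCA => h; lra.
Qed.

(** A bound, uniform in time, on the expected squared distance between two
    devices. *)
Definition consensus_bound : R :=
  if no_drift M H then 0 else 2 * gamma ^+ 2 * sigma ^+ 2 * H%:R.

Lemma consensus_bound_ge0 : 0 <= consensus_bound.
Proof. by rewrite /consensus_bound; case: ifP => // _; rewrite mulr_ge0. Qed.

Lemma consensus_le t m j : (t <= T)%N ->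
  (\int[P]_w (dotv (iterate t m w - iterate t j w)
                   (iterate t m w - iterate t j w))%:E <= consensus_bound%:E)%E.
Proof.
move=> tT; have [->|mj] := eqVneq m j.
  under eq_integral do rewrite subrr dotv0l.
  by rewrite expect_cst lee_fin consensus_bound_ge0.
apply: (le_trans (pairwise_consensus tT mj)); rewrite lee_fin.
rewrite /consensus_bound /no_drift.
have [->|H1] := eqVneq H 1%N; first by rewrite modn1 mulr0n mulr0.
have [M1|_] := eqVneq M 1%N.
  have v0 (i : 'I_M) : val i = 0%N.
    by case: i => i /=; rewrite M1 ltnS leqn0 => /eqP.
  by case/eqP: mj; apply: val_inj; rewrite !v0.
rewrite /= ler_wpM2l //.
by rewrite ler_nat ltnW // ltn_pmod.
Qed.

(** The mean of the devices at time [t]. *)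
Definition mean_iterate (t : nat) (w : Omega) : 'rV[R]_d :=
  device_mean (iterate t ^~ w).

Lemma measurable_mean_iterate t : measurable_vec (mean_iterate t).
Proof. by apply: measurable_vec_mean => m; exact: measurable_iterate. Qed.

(** Communication does not change the mean of the devices. *)
Lemma mean_iterate_step t w :
  mean_iterate t.+1 w =
  mean_iterate t w - gamma *: device_mean (fun m => grad f (iterate t m w))
    + \sum_m (- (gamma / M%:R)) *: noise t m w.
Proof.
have -> : mean_iterate t.+1 w =
    device_mean (fun m =>
      iterate t m w - gamma *: sgrad F (iterate t m w) (z t m w)).
  rewrite /mean_iterate /iterate /=; case: (H %| t.+1)%N => //.
  by rewrite device_mean_cst.
rewrite /mean_iterate /device_mean /noise -[X in _ = _ + X]scaler_sumr !sumrB.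
rewrite -scaler_sumr.
move: (\sum_m iterate t m w) (\sum_m sgrad F (iterate t m w) (z t m w)).
move: (\sum_m grad f (iterate t m w)) => u v y.
by apply/rowP => i; rewrite !mxE; ring.
Qed.

Let dist t w := dotv (mean_iterate t w - xs) (mean_iterate t w - xs).

Let measurable_dist t : measurable_fun [set: Omega] (dist t).
Proof.
by apply: measurable_dotv; apply: measurable_vecB;
  (exact: measurable_mean_iterate || exact: measurable_vec_cst).
Qed.

Let dist_ge0 t w : 0 <= dist t w. Proof. exact: dotvv_ge0. Qed.

Let gap t w := 4 / 3 * gamma * (f (mean_iterate t w) - f xs).

Let measurable_gap t : measurable_fun [set: Omega] (gap t).
Proof.
apply: measurable_funM => //; apply: measurable_funB => //.
by apply: measurable_objective; exact: measurable_mean_iterate.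
Qed.

Let gap_ge0 t w : 0 <= gap t w.
Proof. by rewrite !mulr_ge0 // subr_ge0. Qed.

Let dispersion t w := M%:R^-1 * \sum_m
  dotv (iterate t m w - mean_iterate t w) (iterate t m w - mean_iterate t w).

Let measurable_dispersion t : measurable_fun [set: Omega] (dispersion t).
Proof.
apply: measurable_funM => //; apply: measurable_sum => m.
by apply: measurable_dotv; apply: measurable_vecB;
  (exact: measurable_iterate || exact: measurable_mean_iterate).
Qed.

Let dispersion_ge0 t w : 0 <= dispersion t w.
Proof.
by rewrite mulr_ge0 ?invr_ge0 // sumr_ge0 // => m _; exact: dotvv_ge0.
Qed.

Lemma expected_dispersion t : (t <= T)%N ->
  (\int[P]_w (dispersion t w)%:E <= consensus_bound%:E)%E.
Proof.
move=> tT.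
pose pd m j w := dotv (iterate t m w - iterate t j w)
                      (iterate t m w - iterate t j w).
have mpd m j : measurable_fun [set: Omega] (pd m j).
  by apply: measurable_dotv; apply: measurable_vecB; exact: measurable_iterate.
have pd0 m j w : 0 <= pd m j w by exact: dotvv_ge0.
pose c : R := M%:R^-1 * M%:R^-1.
have c0 : 0 <= c by rewrite mulr_ge0 ?invr_ge0.
have mcpd m j : measurable_fun [set: Omega] (fun w => c * pd m j w).
  exact: measurable_funM.
have cpd0 m j w : 0 <= c * pd m j w by rewrite mulr_ge0.
pose pairs w := \sum_m \sum_j c * pd m j w.
apply: (@le_trans _ _ (\int[P]_w (pairs w)%:E)%E).
  apply: expect_le => //.
    by apply: measurable_sum => m; exact: measurable_sum.
  move=> w; rewrite /pairs; under eq_bigr do rewrite -mulr_sumr.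
  rewrite -mulr_sumr /c -mulrA ler_wpM2l ?invr_ge0 //.
  exact: mean_consensus_le.
have -> : consensus_bound = \sum_(m < M) \sum_(j < M) c * consensus_bound.
  rewrite !sumr_const !card_ord -[c * _ *+ M]mulr_natl.
  rewrite -[_ * (c * _) *+ M]mulr_natl /c.
  have MR0 : M%:R != 0 :> R by rewrite pnatr_eq0 -lt0n.
  by field.
apply: expect_sum_le => [m|m w|m]; first exact: measurable_sum.
  exact: sumr_ge0.
apply: expect_sum_le => // j.
by rewrite expectZ // [leRHS]EFinM lee_wpmul2l ?lee_fin // consensus_le.
Qed.

Let step_error := 4 / 3 * gamma * LR * consensus_bound
                  + gamma ^+ 2 * sigma ^+ 2 / M%:R.

Lemma expected_descent t : (t < T)%N ->
  (\int[P]_w (dist t.+1 w)%:E + \int[P]_w (gap t w)%:E <=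
   \int[P]_w (dist t w)%:E + step_error%:E)%E.
Proof.
move=> tT.
pose drift w := mean_iterate t w
  - gamma *: device_mean (fun m => grad f (iterate t m w)) - xs.
have mdrift (dW : measure_display) (W : measurableType dW)
    (y : W -> 'I_M -> 'rV[R]_d) :
    (forall m, measurable_vec (y^~ m)) ->
    measurable_vec (fun w => device_mean (y w)
      - gamma *: device_mean (fun m => grad f (y w m)) - xs).
  move=> my; apply: measurable_vecB; last exact: measurable_vec_cst.
  apply: measurable_vecB; first exact: measurable_vec_mean.
  apply: measurable_vecZ; apply: measurable_vec_mean => m.
  exact: measurable_grad_objective.
have md : measurable_vec drift.
  apply: (mdrift _ _ (fun w m => iterate t m w)) => m.
  exact: measurable_iterate.
have mdd : measurable_fun [set: Omega] (fun w => dotv (drift w) (drift w)).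
  exact: measurable_dotv.
have -> : (\int[P]_w (dist t.+1 w)%:E =
    \int[P]_w (dotv (drift w + \sum_m (- (gamma / M%:R)) *: noise t m w)
      (drift w + \sum_m (- (gamma / M%:R)) *: noise t m w))%:E)%E.
  apply: eq_integral => w _; rewrite /dist mean_iterate_step /drift.
  by rewrite [_ + _ - xs]addrAC.
have mdo j : measurable_vec
    (drift : others (fun k : 'I_T * 'I_M => z k.1 k.2) (Ordinal tT, j) -> _).
  apply: (mdrift _ (others _ _) (fun w m => iterate t m w)) => m.
  exact: measurable_iterate_others.
have noisy := @noise_sum _ tT (index_enum 'I_M) (fun=> - (gamma / M%:R)) drift
  (index_enum_uniq _) md mdo.
have errE : (\sum_(j < M) (- (gamma / M%:R)) ^+ 2) * sigma ^+ 2 =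
    gamma ^+ 2 * sigma ^+ 2 / M%:R.
  have MR0 : M%:R != 0 :> R by rewrite pnatr_eq0 -lt0n.
  by rewrite sumr_const card_ord -[_ *+ M]mulr_natl; field.
rewrite errE in noisy.
apply: (le_trans (leeD2r _ noisy)).
rewrite addeAC [X in (X + _)%E](_ : _ =
  (\int[P]_w (dotv (drift w) (drift w) + gap t w)%:E)%E); last first.
  by rewrite expectD // => w; exact: dotvv_ge0.
rewrite /step_error [in leRHS]EFinD addeA leeD2r //.
have c0 : 0 <= 4 / 3 * gamma * LR by rewrite !mulr_ge0.
rewrite EFinM.
apply: (@le_trans _ _ (\int[P]_w (dist t w)%:E +
    (4 / 3 * gamma * LR)%:E * \int[P]_w (dispersion t w)%:E)%E); last first.
  by rewrite leeD2l // lee_wpmul2l ?lee_fin // expected_dispersion // ltnW.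
rewrite -expectZ // -expectD //; last 2 first.
- exact: measurable_funM.
- by move=> w; rewrite mulr_ge0.
apply: expect_le => [| |w|w].
- exact: measurable_funD.
- by apply: measurable_funD => //; exact: measurable_funM.
- by rewrite addr_ge0 // dotvv_ge0.
- exact: (mean_descent M0 L0 fE quadQ cQ cr sr sf fmin
    (fun m => iterate t m w) g0 gL).
Qed.

Lemma expected_telescope n : (n <= T)%N ->
  (\int[P]_w (dist n w)%:E + \sum_(t < n) \int[P]_w (gap t w)%:E <=
   (dotv (x0 - xs) (x0 - xs) + n%:R * step_error)%:E)%E.
Proof.
elim: n => [_|n IH nT].
  rewrite big_ord0 adde0 mul0r addr0.
  under eq_integral do
    rewrite /dist /mean_iterate /iterate /= device_mean_cst //.
  by rewrite expect_cst.
rewrite big_ord_recr /= [X in (_ + X)%E]addeC addeA.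
apply: (le_trans (leeD2r _ (expected_descent nT))).
rewrite addeAC -[n.+1%:R]natr1 mulrDl mul1r addrA [leRHS]EFinD leeD2r //.
exact: IH (ltnW nT).
Qed.

(** The suboptimality of the averaged iterate, as a function of the stepsize. *)
Lemma expected_gap_average : (0 < T)%N -> 0 < gamma ->
  let xavg w := local_sgd_avg F H (fun=> gamma) x0 (fun t m => z t m w) T in
  measurable_fun [set: Omega] (fun w => f (xavg w)) /\
  (\int[P]_w (f (xavg w) - f xs)%:E <=
   (dotv (x0 - xs) (x0 - xs) / (gamma * T%:R) + LR * consensus_bound
    + gamma * sigma ^+ 2 / M%:R)%:E)%E.
Proof.
move=> T0 gamma0 xavg.
have TR0 : 0 < T%:R :> R by rewrite ltr0n.
have MR0 : 0 < M%:R :> R by rewrite ltr0n.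
have xavgE w : xavg w = device_mean (fun t : 'I_T => mean_iterate t w) by [].
have mavg : measurable_vec xavg.
  apply: (measurable_vec_mean (u := fun w (t : 'I_T) => mean_iterate t w)) => t.
  exact: measurable_mean_iterate.
have mf := measurable_objective mavg.
split; first exact: mf.
have mgap : measurable_fun [set: Omega] (fun w => f (xavg w) - f xs).
  exact: measurable_funB.
have gap0 w : 0 <= f (xavg w) - f xs by rewrite subr_ge0.
pose c := T%:R * (4 / 3 * gamma).
have c0 : 0 < c by rewrite !mulr_gt0.
have le_sum w : c * (f (xavg w) - f xs) <= \sum_(t < T) gap t w.
  rewrite /gap -mulr_sumr sumrB sumr_const card_ord -[f xs *+ T]mulr_natl.
  rewrite /c -mulrA mulrCA ler_wpM2l ?mulr_ge0 //.
  have := convex_mean_le (fun t : 'I_T => mean_iterate t w) T0 cf.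
  by rewrite -xavgE ler_pdivlMl // mulrBr => h; rewrite lerD2r.
have bound : (c%:E * \int[P]_w (f (xavg w) - f xs)%:E <=
    (dotv (x0 - xs) (x0 - xs) + T%:R * step_error)%:E)%E.
  rewrite -expectZ //; last exact: ltW.
  apply: le_trans (expected_telescope (leqnn T)).
  apply: (@le_trans _ _ (\sum_(t < T) \int[P]_w (gap t w)%:E)%E); last first.
    by rewrite leeDr //; apply: integral_ge0 => w _; rewrite lee_fin.
  rewrite -ge0_integral_sum //; last 2 first.
  - by move=> t; exact/measurable_EFinP.
  - by move=> t w _; rewrite lee_fin.
  under [leRHS]eq_integral do rewrite sumEFin.
  apply: expect_le => //; first exact: measurable_funM.
    exact: measurable_sum.
  by move=> w; rewrite mulr_ge0 // ltW.
have := bound; rewrite -lee_pdivlMl //; move/le_trans; apply.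
rewrite -EFinM lee_fin /step_error /c.
set A := dotv _ _.
have A0 : 0 <= A by exact: dotvv_ge0.
have -> : (T%:R * (4 / 3 * gamma))^-1 * (A + T%:R *
     (4 / 3 * gamma * LR * consensus_bound + gamma ^+ 2 * sigma ^+ 2 / M%:R)) =
   3 / 4 * (A / (gamma * T%:R)) + LR * consensus_bound +
   3 / 4 * (gamma * sigma ^+ 2 / M%:R).
  by field; rewrite !gt_eqF.
have h1 : 0 <= A / (gamma * T%:R) by rewrite divr_ge0 // mulr_ge0.
have h2 : 0 <= gamma * sigma ^+ 2 / M%:R.
  by rewrite divr_ge0 // mulr_ge0 // sqr_ge0.
lra.
Qed.

End Descent.
End LocalSGD.

(** * Choice of the stepsize *)

Section Stepsize.
Context {R : realType}.


Lemma eq_minP (u v : \bar R) x : x = Order.min u v ->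
  [/\ (x <= u)%E, (x <= v)%E & x = u \/ x = v].
Proof.
move=> ->; split; [by rewrite ge_min lexx | by rewrite ge_min lexx orbT |].
by rewrite minEle; case: ifP; [left|right].
Qed.

(** The candidate stepsize that balances the initial distance with the
    variance of the averaged noise. *)
Definition variance_step (sigma r0 : R) (M T : nat) : R :=
  r0 * Num.sqrt M%:R / (sigma * Num.sqrt T%:R).

(** The candidate stepsize that balances the initial distance with the
    consensus error. *)
Definition drift_step (LR sigma r0 : R) (H T : nat) : R :=
  (r0 ^+ 2 / (LR * sigma ^+ 2 * T%:R * H%:R)) `^ 3^-1.

(** The infinite candidates drop out of the minimum: the stepsize is below all
    the finite candidates and equal to one of them. *)
Lemma stepsizeP (L LR sigma r0 gamma : R) (M H T : nat) :
  0 < L -> (0 < T)%N -> (0 < H)%N ->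
  gamma%:E = stepsize L LR sigma r0 M H T ->
  [/\ gamma <= (6 * L)^-1,
      sigma != 0 -> gamma <= variance_step sigma r0 M T,
      ~~ no_drift M H -> LR * sigma ^+ 2 != 0 ->
        gamma <= drift_step LR sigma r0 H T &
      [\/ gamma = (6 * L)^-1,
          sigma != 0 /\ gamma = variance_step sigma r0 M T |
          [/\ ~~ no_drift M H, LR * sigma ^+ 2 != 0 &
              gamma = drift_step LR sigma r0 H T]]].
Proof.
move=> L0 T0 H0; rewrite /stepsize -/(no_drift M H).
have TR0 : T%:R != 0 :> R by rewrite pnatr_eq0 -lt0n.
have HR0 : H%:R != 0 :> R by rewrite pnatr_eq0 -lt0n.
have sT0 : Num.sqrt T%:R != 0 :> R by rewrite gt_eqF // sqrtr_gt0 ltr0n.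
set b := divy (r0 * _) _; set c := poweR _ _.
have -> : divy 1 (6 * L) = (6 * L)^-1%:E.
  by rewrite /divy gt_eqF ?mulr_gt0 // mul1r.
have bE : sigma != 0 -> b = (variance_step sigma r0 M T)%:E.
  by move=> s0; rewrite /b /divy mulf_eq0 (negbTE s0) (negbTE sT0).
have bE0 : sigma == 0 -> b = +oo%E.
  by move=> /eqP s0; rewrite /b /divy s0 mul0r eqxx.
have cE : LR * sigma ^+ 2 != 0 -> c = (drift_step LR sigma r0 H T)%:E.
  move=> s0; rewrite /c /divy mulf_eq0 (negbTE HR0) mulf_eq0 (negbTE TR0).
  by rewrite (negbTE s0).
have cE0 : LR * sigma ^+ 2 == 0 -> c = +oo%E.
  move=> /eqP s0; rewrite /c /divy s0 !mul0r eqxx poweRyr //.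
have bcase : gamma%:E = b -> sigma != 0 /\ gamma = variance_step sigma r0 M T.
  by have [/bE0 ->|s0] := boolP (sigma == 0) => //; rewrite bE // => -[].
have ccase : gamma%:E = c ->
    LR * sigma ^+ 2 != 0 /\ gamma = drift_step LR sigma r0 H T.
  have [/cE0 ->|s0] := boolP (LR * sigma ^+ 2 == 0) => //.
  by rewrite cE // => -[].
case: ifP => nd /eq_minP[]; rewrite lee_fin => gL.
  move=> gb ab; split => //.
  - by move=> s0; rewrite -lee_fin -bE.
  - by case: ab => [[->]|/bcase]; [constructor 1|constructor 2].
move=> gbc abc; have gb : (gamma%:E <= b)%E.
  by apply: (le_trans gbc); rewrite ge_min lexx.
have gc : (gamma%:E <= c)%E.
  by apply: (le_trans gbc); rewrite ge_min lexx orbT.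
split => //.
- by move=> s0; rewrite -lee_fin -bE.
- by move=> _ s0; rewrite -lee_fin -cE.
- case: abc => [[->]|/eq_minP[_ _ [/bcase|/ccase[]]]]; first by constructor 1.
    by constructor 2.
  by constructor 3.
Qed.

Lemma cube_root_cube (x : R) : 0 <= x -> (x `^ 3^-1) ^+ 3 = x.
Proof.
by move=> x0; rewrite -powR_mulrn ?powR_ge0 // -powRrM mulVf // powRr1.
Qed.

Lemma le_of_cube (x y : R) : 0 <= y -> x ^+ 3 <= y ^+ 3 -> x <= y.
Proof.
move=> y0; have [x0|x0 _] := leP 0 x; first by rewrite ler_pXn2r.
by apply: le_trans y0; exact: ltW.
Qed.

(** With the prescribed stepsize, the optimization, consensus and variance
    errors are balanced. *)
Lemma stepsize_balance (L LR sigma r0 gamma : R) (M H K : nat) :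
  let T := (K * H)%N in
  (0 < M)%N -> (0 < H)%N -> (0 < K)%N -> 0 < L -> 0 <= LR -> 0 <= sigma ->
  0 <= r0 -> 0 < gamma ->
  gamma%:E = stepsize L LR sigma r0 M H T ->
  r0 ^+ 2 / (gamma * T%:R)
    + LR * (if no_drift M H then 0 else 2 * gamma ^+ 2 * sigma ^+ 2 * H%:R)
    + gamma * sigma ^+ 2 / M%:R <=
  6 * (L * r0 ^+ 2 / T%:R + sigma * r0 / Num.sqrt (M%:R * T%:R)
       + (LR / L * L * sigma ^+ 2 * r0 ^+ 4 / (T%:R * K%:R)) `^ 3^-1).
Proof.
move=> T M0 H0 K0 L0 LR0 s0 r00 g0 stepE.
have T0 : (0 < T)%N by rewrite /T muln_gt0 K0.
have [_ gb gc gcase] := stepsizeP L0 T0 H0 stepE.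
have TE : T%:R = K%:R * H%:R :> R by rewrite /T natrM.
have TR : 0 < T%:R :> R by rewrite ltr0n.
have MR : 0 < M%:R :> R by rewrite ltr0n.
have HR : 0 < H%:R :> R by rewrite ltr0n.
have KR : 0 < K%:R :> R by rewrite ltr0n.
have pT : 0 < Num.sqrt T%:R :> R by rewrite sqrtr_gt0.
have pM : 0 < Num.sqrt M%:R :> R by rewrite sqrtr_gt0.
have sT : Num.sqrt T%:R ^+ 2 = T%:R :> R by rewrite sqr_sqrtr // ltW.
have sM : Num.sqrt M%:R ^+ 2 = M%:R :> R by rewrite sqr_sqrtr // ltW.
have s20 : 0 <= sigma ^+ 2 by exact: sqr_ge0.
rewrite divfK ?gt_eqF // sqrtrM ?ler0n //.
set B := sigma * r0 / _; set C := _ `^ _.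
have B0 : 0 <= B by rewrite divr_ge0 ?mulr_ge0 // ltW.
have C0 : 0 <= C by exact: powR_ge0.
have C3 : C ^+ 3 = LR * sigma ^+ 2 * r0 ^+ 4 / (T%:R * K%:R).
  rewrite cube_root_cube // divr_ge0 ?mulr_ge0 ?exprn_ge0 //.
have A0 : 0 <= L * r0 ^+ 2 / T%:R.
  by rewrite divr_ge0 ?mulr_ge0 ?sqr_ge0 // ltW.
have drift3 : LR * sigma ^+ 2 != 0 -> drift_step LR sigma r0 H T ^+ 3 =
    r0 ^+ 2 / (LR * sigma ^+ 2 * T%:R * H%:R).
  move=> Ls; rewrite /drift_step cube_root_cube //.
  by rewrite divr_ge0 ?mulr_ge0 ?sqr_ge0 // ltW.
have t1 : r0 ^+ 2 / (gamma * T%:R) <= 6 * (L * r0 ^+ 2 / T%:R) + B + C.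
  case: gcase => [gE|[sn0 gE]|[nd Ls gE]].
  - rewrite gE (_ : r0 ^+ 2 / ((6 * L)^-1 * T%:R) = 6 * (L * r0 ^+ 2 / T%:R)).
      lra.
    by field; rewrite !gt_eqF.
  - have rn0 : r0 != 0.
      by apply: contraTneq g0 => r0E; rewrite gE /variance_step r0E !mul0r ltxx.
    rewrite (_ : r0 ^+ 2 / (gamma * T%:R) = B); first lra.
    rewrite gE /variance_step /B.
    transitivity (r0 ^+ 2 / (r0 * Num.sqrt M%:R / (sigma * Num.sqrt T%:R)
                             * Num.sqrt T%:R ^+ 2)); first by rewrite sT.
    by field; rewrite sn0 rn0 !gt_eqF.
  - rewrite (_ : r0 ^+ 2 / (gamma * T%:R) = C); first lra.
    have rn0 : r0 != 0.
      apply: contraTneq g0 => r0E.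
      by rewrite gE /drift_step r0E expr0n mul0r powR0 ?invr_eq0 // ltxx.
    have lhs0 : 0 <= r0 ^+ 2 / (gamma * T%:R).
      by rewrite divr_ge0 ?sqr_ge0 // mulr_ge0 // ltW.
    have [Ln0 sn0] : LR != 0 /\ sigma != 0.
      by move: Ls; rewrite mulf_eq0 sqrf_eq0 negb_or => /andP[].
    have E3 : (r0 ^+ 2 / (gamma * T%:R)) ^+ 3 = C ^+ 3.
      rewrite gE expr_div_n [(_ * T%:R) ^+ 3]exprMn drift3 // C3 TE; field.
      by rewrite Ln0 sn0 rn0 !gt_eqF.
    by apply/le_anti/andP; split; apply: le_of_cube => //; rewrite E3.
have t2 : LR * (if no_drift M H then 0 else 2 * gamma ^+ 2 * sigma ^+ 2 * H%:R)
    <= 2 * C.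
  case: ifPn => nd; first by rewrite mulr0 mulr_ge0.
  rewrite (_ : LR * _ = 2 * (LR * sigma ^+ 2 * H%:R * gamma ^+ 2)); last ring.
  rewrite ler_wpM2l //.
  have [->|Ls] := eqVneq (LR * sigma ^+ 2) 0; first by rewrite !mul0r.
  apply: le_of_cube => //.
  have g3 : (gamma ^+ 3) ^+ 2 <=
      (r0 ^+ 2 / (LR * sigma ^+ 2 * T%:R * H%:R)) ^+ 2.
    rewrite -drift3 // ler_pXn2r // ?nnegrE ?exprn_ge0 ?powR_ge0 ?(ltW g0) //.
    by rewrite ler_pXn2r // ?nnegrE ?powR_ge0 ?(ltW g0) //; exact: gc.
  have Lsn : 0 <= (LR * sigma ^+ 2 * H%:R) ^+ 3.
    by rewrite exprn_ge0 // !mulr_ge0.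
  have [Ln0 sn0] : LR != 0 /\ sigma != 0.
    by move: Ls; rewrite mulf_eq0 sqrf_eq0 negb_or => /andP[].
  rewrite exprMn -exprM mulnC exprM.
  apply: (le_trans (ler_wpM2l Lsn g3)).
  rewrite C3 TE le_eqVlt; apply/orP; left; apply/eqP; field.
  by rewrite Ln0 sn0 !gt_eqF.
have t3 : gamma * sigma ^+ 2 / M%:R <= B.
  have [->|sn0] := eqVneq sigma 0; first by rewrite expr0n mulr0 mul0r.
  have h := ler_wpM2r s20 (gb sn0).
  rewrite ler_pdivrMr //; apply: (le_trans h).
  rewrite le_eqVlt; apply/orP; left; apply/eqP.
  transitivity (sigma * r0 / (Num.sqrt M%:R * Num.sqrt T%:R)
                * Num.sqrt M%:R ^+ 2); last by rewrite sM.
  by rewrite /variance_step; field; rewrite sn0 !gt_eqF.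
lra.
Qed.

End Stepsize.

Lemma local_sgd_step0 (R : realType) (d M : nat) (Z : Type)
    (F : 'rV[R]_d -> Z -> R) (H : nat) (x0 : 'rV[R]_d)
    (zs : nat -> 'I_M -> Z) t m : (0 < M)%N ->
  local_sgd F H (fun=> 0) x0 zs t m = x0.
Proof.
move=> M0; elim: t m => [//|t IH] m /=.
have -> : (fun j => local_sgd F H (fun=> 0) x0 zs t j -
    0 *: sgrad F (local_sgd F H (fun=> 0) x0 zs t j) (zs t j)) = (fun=> x0).
  by apply/funext => j; rewrite scale0r subr0 IH.
by case: (H %| t.+1)%N; rewrite ?device_mean_cst.
Qed.

(** * The convergence bound *)

Theorem theorem2 (R : realType) :
  exists A : R, 0 < A /\
  forall (d M H K : nat)
    (dZ dO : measure_display) (Z : measurableType dZ) (Omega : measurableType dO)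
    (D : probability Z R) (P : probability Omega R)
    (F : 'rV[R]_d -> Z -> R) (Q Rem : 'rV[R]_d -> R)
    (muQ LQ muR LR L sigma gamma : R) (x0 xstar : 'rV[R]_d)
    (z : nat -> 'I_M -> {RV P >-> Z}),
  let f := objective D F in
  let T := (K * H)%N in
  let eps := LR / L in
  let r0 := enorm (x0 - xstar) in
  let xtilde := fun w : Omega =>
    local_sgd_avg F H (fun=> gamma) x0 (fun t m => z t m w) T in
  (0 < M)%N -> (0 < H)%N -> (0 < K)%N -> 0 < L ->
  stochastic_function D F ->
  (forall x, f xstar <= f x) ->
  eps_decomposition f Q Rem muQ LQ muR LR L ->
  muQ + muR = 0 ->
  stochastic_oracle D F sigma 0 ->
  iid_draws D T z ->
  gamma%:E = stepsize L LR sigma r0 M H T ->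
  ('E_P[fun w => f (xtilde w)] - (f xstar)%:E <=
   (A * (L * r0 ^+ 2 / T%:R
         + sigma * r0 / Num.sqrt (M%:R * T%:R)
         + (eps * L * sigma ^+ 2 * r0 ^+ 4 / (T%:R * K%:R)) `^ 3^-1))%:E)%E.
Proof.
(* The initial distance over [gamma T] costs [6 L r0 ^ 2 / T] plus the two other
   terms; the latter occur at most three times in total. *)
exists 6; split => //.
move=> d M H K dZ dO Z Omega D P F Q Rem muQ LQ muR LR L sigma gamma x0 xstar z.
move=> f T eps r0 xtilde M0 H0 K0 L0 stochF fmin [fE].
move=> [quadQ muQ0 cQ sQ] [muR0 cr sr] sf mu0 oracle iid stepE.
have T0 : (0 < T)%N by rewrite /T muln_gt0 K0.
have [mQ0 mR0] : muQ = 0 /\ muR = 0 by split; lra.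
rewrite {}mQ0 in cQ; rewrite {}mR0 in cr.
have sigma0 : 0 <= sigma by case: oracle.
have r00 : 0 <= r0 by exact: enorm_ge0.
have r02 : r0 ^+ 2 = dotv (x0 - xstar) (x0 - xstar) by exact: sqr_enorm.
have trivial_case : r0 = 0 -> (forall w, xtilde w = xstar) ->
  ('E_P[fun w => f (xtilde w)] - (f xstar)%:E <=
   (6 * (L * r0 ^+ 2 / T%:R
         + sigma * r0 / Num.sqrt (M%:R * T%:R)
         + (eps * L * sigma ^+ 2 * r0 ^+ 4 / (T%:R * K%:R)) `^ 3^-1))%:E)%E.
  move=> rE xE; rewrite unlock; under eq_integral do rewrite xE.
  rewrite expect_cst rE !expr0n /= !(mulr0, mul0r) powR0 ?invr_eq0 //.
  by rewrite !addr0 mulr0 -EFinB subrr.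
have [LRneg|LR0] := ltP LR 0.
  (* A convex function is LR-smooth with LR < 0 only in dimension 0. *)
  have eq_all (x y : 'rV[R]_d) : x = y.
    apply/subr0_eq/dotvv_eq0/eqP; rewrite eq_le dotvv_ge0 andbT.
    have := le_trans (bregman_ge0 y x cr) (bregman_le y x sr).
    by rewrite nmulr_rge0 // nmulr_rlt0.
  apply: trivial_case => [|w]; last exact: eq_all.
  by apply/eqP; rewrite -sqrf_eq0 r02 (eq_all x0 xstar) subrr dotv0l.
have [g1 gb gc gcase] := stepsizeP L0 T0 H0 stepE.
have gamma0 : 0 <= gamma.
  case: gcase => [->|[_ ->]|[_ _ ->]]; last exact: powR_ge0.
    by rewrite invr_ge0 mulr_ge0 // ltW.
  by rewrite divr_ge0 ?mulr_ge0 ?sqrtr_ge0.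
have [gE|gn0] := eqVneq gamma 0.
  (* All the finite candidates for the stepsize are positive when r0 is. *)
  have rE : r0 = 0.
    apply/eqP/contraT => rn0; have rpos : 0 < r0 by rewrite lt0r rn0.
    have TR : 0 < T%:R :> R by rewrite ltr0n.
    case: gcase; rewrite gE.
    - by move=> /esym/eqP; rewrite gt_eqF // invr_gt0 mulr_gt0.
    - move=> [sn0 /esym/eqP]; have spos : 0 < sigma by rewrite lt0r sn0.
      have pM : 0 < Num.sqrt M%:R :> R by rewrite sqrtr_gt0 ltr0n.
      have pT : 0 < Num.sqrt T%:R :> R by rewrite sqrtr_gt0.
      by rewrite gt_eqF // divr_gt0 // mulr_gt0.
    - move=> [_ Ls /esym/eqP]; rewrite gt_eqF //.
      rewrite powR_gt0 // divr_gt0 ?exprn_gt0 //.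
      apply: mulr_gt0; last by rewrite ltr0n.
      apply: mulr_gt0 => //.
      by rewrite lt0r Ls mulr_ge0 // sqr_ge0.
  apply: trivial_case => // w.
  have xE : x0 = xstar by apply/subr0_eq/dotvv_eq0; rewrite -r02 rE expr0n.
  rewrite /xtilde gE.
  have -> : local_sgd_avg F H (fun=> 0) x0 (fun t m => z t m w) T =
      device_mean (fun _ : 'I_T => x0).
    rewrite /local_sgd_avg; congr (_ *: _); apply: eq_bigr => t _.
    rewrite (_ : local_sgd _ _ _ _ _ _ = fun=> x0) ?device_mean_cst //.
    by apply/funext => m; rewrite local_sgd_step0.
  by rewrite device_mean_cst.
have gpos : 0 < gamma by rewrite lt0r gn0.
have gL : gamma * (6 * L) <= 1.
  by rewrite -ler_pdivlMr ?mulr_gt0 // mul1r.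
have df x : differentiable f x by case: sf.
have [mf gapb] := expected_gap_average x0 M0 stochF oracle iid df H0 L0 LR0 fE
  quadQ cQ cr sr sf fmin gamma0 gL T0 gpos.
have balance := stepsize_balance M0 H0 K0 L0 LR0 sigma0 r00 gpos stepE.
rewrite -r02 in gapb.
pose gap w := f (xtilde w) - f xstar.
have gap0 w : 0 <= gap w by rewrite subr_ge0.
have mgap : measurable_fun [set: Omega] gap by exact: measurable_funB.
have igap : P.-integrable setT (EFin \o gap).
  apply/integrableP; split; first exact/measurable_EFinP.
  rewrite (eq_integral (fun w => (gap w)%:E)).
    exact: le_lt_trans gapb (ltry _).
  by move=> w _ /=; rewrite ger0_norm.
have meanE : ('E_P[fun w => f (xtilde w)] =
    \int[P]_w (gap w)%:E + (f xstar)%:E)%E.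
  rewrite unlock -(expect_cst P (f xstar)).
  rewrite -(integralD measurableT igap) //; last first.
    exact: finite_measure_integrable_cst.
  by apply: eq_integral => w _; rewrite -EFinD subrK.
rewrite meanE addeK //; apply: (le_trans gapb).
by rewrite lee_fin.
Qed.
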